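(* Let $(\mathcal{X}, \mathcal{S}, \mu)$ be a Lebesgue probability space, and let $\mathcal{C} \subseteq \mathcal{S}$ be a family of measurable subsets of $\mathcal{X}$. Then $H_\mu(\mathcal{C}) = 0$ if and only if, for every ergodic measure preserving transformation $T$ of $(\mathcal{X}, \mathcal{S}, \mu)$, $$\sup_{C \in \mathcal{C}} \int \Big| \frac{1}{n} \sum_{i=0}^{n-1} I_C(T^i x) - \mu(C) \Big| \, d\mu(x) \to 0 \quad \text{as } n \to \infty.$$
   Context: A Lebesgue probability space is a probability space isomorphic (modulo null sets) to the unit interval $[0,1)$ with Lebesgue measure. $I_C$ denotes the indicator function of $C$. Entropy of a family. For a finite measurable partition $\Pi$ of $\mathcal{X}$, $H_\mu(\Pi) = -\sum_{A \in \Pi} \mu(A) \log \mu(A)$, with logarithms base 2 (cells are assumed, without loss of generality, to have positive measure, i.e. null cells contribute 0). For measurable sets $C_1, \ldots, C_n$, the join $\vee_{i=1}^n C_i$ is the partition of $\mathcal{X}$ with cells $\tilde{C}_1 \cap \cdots \cap \tilde{C}_n$, where each $\tilde{C}_i \in \{C_i, C_i^c\}$. For an ordered sequence $\mathbb{S} = (C_1, C_2, \ldots)$ of sets $C_i \in \mathcal{C}$, let $H_\mu(\mathbb{S}) = \liminf_{n\to\infty} \frac{1}{n} H_\mu(\vee_{i=1}^n C_i)$. The entropy of the family $\mathcal{C} \subseteq \mathcal{S}$ is $H_\mu(\mathcal{C}) = \sup H_\mu(\mathbb{S})$, where the supremum is over all ordered sequences $\mathbb{S}$ of sets in $\mathcal{C}$.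 *)

(* Defs.v *)
From HB Require Import structures.
From mathcomp Require Import all_boot all_order all_algebra.
From mathcomp Require Import all_classical all_reals all_analysis.

Set Implicit Arguments.
Unset Strict Implicit.
Unset Printing Implicit Defensive.

Import Order.TTheory GRing.Theory Num.Theory.
Import numFieldNormedType.Exports.

Local Open Scope classical_set_scope.
Local Open Scope ring_scope.

(* Since f is injective on X0, the last clause says both that the inverse of f
   is measurable and that f and its inverse preserve measure. *)
Definition isomorphic_mod_null (d1 d2 : measure_display)
    (X : measurableType d1) (Y : measurableType d2) (R : realType)
    (mu : {measure set X -> \bar R}) (nu : {measure set Y -> \bar R})
    (E : set Y) : Prop :=
  exists (X0 : set X) (Y0 : set Y) (f : X -> Y),
    [/\ measurable X0 /\ mu (~` X0) = 0%E,
        [/\ measurable Y0, Y0 `<=` E & nu (E `\` Y0) = 0%E],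
        set_bij X0 Y0 f,
        measurable_fun X0 f
      & forall A : set X, measurable A -> A `<=` X0 ->
          measurable (f @` A) /\ nu (f @` A) = mu A].

(* The interval [0, 1) may carry either its Borel sets or its Lebesgue
   measurable sets; the two give different classes of sigma-algebras on X (the
   standard Borel one and its completion), and both are admitted. *)
Definition lebesgue_probability_space (d : measure_display)
    (X : measurableType d) (R : realType) (mu : probability X R) : Prop :=
  isomorphic_mod_null mu (@lebesgue_measure R) [set x : R | 0 <= x < 1] \/
  isomorphic_mod_null mu (@completed_lebesgue_measure R)
    [set x : R | 0 <= x < 1].

(* In MathComp-Analysis ln 0 = 0, so null cells contribute 0. *)
Definition log2 (R : realType) (x : R) : R := ln x / ln 2.

Definition partition_entropy (d : measure_display) (X : measurableType d)
    (R : realType) (mu : probability X R) (I : finType) (A : I -> set X) : R :=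
  - \sum_(i : I) fine (mu (A i)) * log2 (fine (mu (A i))).

(* The cells of the join of C 0, ..., C n.-1, indexed by the choices b of C i
   or its complement; cells with distinct indices are disjoint, so the indexing
   repeats no cell other than the empty one, which contributes 0. *)
Definition join_cell (X : Type) (C : nat -> set X) (n : nat)
    (b : {ffun 'I_n -> bool}) : set X :=
  \bigcap_(i in [set: 'I_n]) (if b i then C i else ~` C i).

Definition sequence_entropy (d : measure_display) (X : measurableType d)
    (R : realType) (mu : probability X R) (C : nat -> set X) : \bar R :=
  limn_einf (fun n : nat =>
    (n%:R^-1 * partition_entropy mu (join_cell C (n := n)))%:E).

Definition family_entropy (d : measure_display) (X : measurableType d)
    (R : realType) (mu : probability X R) (F : set (set X)) : \bar R :=
  ereal_sup [set sequence_entropy mu C | C in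
    [set C : nat -> set X | forall i, F (C i)]].

Definition measure_preserving (d : measure_display) (X : measurableType d)
    (R : realType) (mu : probability X R) (T : X -> X) : Prop :=
  measurable_fun [set: X] T /\
  forall A : set X, measurable A -> mu (T @^-1` A) = mu A.

Definition ergodic (d : measure_display) (X : measurableType d)
    (R : realType) (mu : probability X R) (T : X -> X) : Prop :=
  forall A : set X, measurable A -> T @^-1` A = A -> mu A = 0%E \/ mu A = 1%E.

Definition ergodic_deviation (d : measure_display) (X : measurableType d)
    (R : realType) (mu : probability X R) (T : X -> X) (C : set X) (n : nat) :
    \bar R :=
  (\int[mu]_x
    `| n%:R^-1 * \sum_(0 <= i < n) \1_C (iter i T x) - fine (mu C) |%:E)%E.

(* Main.v *)
(* Both conditions are equivalent to F being totally bounded for the metric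
   mu (C symmetric-difference D).

   Entropy. If F has finite nets, Gibbs' inequality bounds the entropy of a join
   of n members of F by a constant plus a small multiple of n. Otherwise there
   is e > 0 such that every finite partition has a member of F at distance at
   least e from all unions of its cells; adding it to a join increases the
   entropy by at least e, and iterating gives linear growth.

   Averages. For a single set the mean ergodic theorem follows from the covering
   argument of Katznelson and Weiss, and finite nets make it uniform. If F is
   not totally bounded, an odometer T on X is built by refining cyclically
   ordered partitions into N(k) cells of equal measure. At stage k take C in F
   at distance at least e from the unions of cells, and cut every cell into q
   equal pieces, first the points of C, then the others, both ordered by a
   coordinate of X in [0, 1). Running through the cells in cyclic order along
   one piece number, C is seen more often in the first q / 2 rounds than in the
   last ones, so its average over N(k) steps is not close to mu C. The ordering
   also makes most pieces small, so that the limit is a point map. T is ergodic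
   because an invariant set is independent of all the partitions. *)

Require Import Defs.
From HB Require Import structures.
From mathcomp Require Import all_boot all_order all_algebra.
From mathcomp Require Import all_classical all_reals all_analysis.
From mathcomp Require Import measurable_realfun ring lra.

Set Implicit Arguments.
Unset Strict Implicit.
Unset Printing Implicit Defensive.

Import Order.TTheory GRing.Theory Num.Theory.
Import numFieldNormedType.Exports.

Local Open Scope classical_set_scope.
Local Open Scope ring_scope.

Definition symdiff (X : Type) (A B : set X) : set X := (A `\` B) `|` (B `\` A).

Lemma measurable_symdiff (d : measure_display) (X : measurableType d)
    (A B : set X) : measurable A -> measurable B -> measurable (symdiff A B).
Proof. by move=> mA mB; apply: measurableU; exact: measurableD. Qed.

(** * Measurable sets and bounded functions on a probability space *)

Section real_probability.
Context {R : realType} {d : measure_display} {X : measurableType d}.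
Variable mu : probability X R.

Definition pr (A : set X) : R := fine (mu A).

Lemma prE A : measurable A -> mu A = (pr A)%:E.
Proof. by move=> mA; rewrite /pr fineK// fin_num_measure. Qed.

Lemma pr_ge0 A : 0 <= pr A.
Proof. by rewrite /pr fine_ge0. Qed.

Lemma pr_le A B : measurable A -> measurable B -> A `<=` B -> pr A <= pr B.
Proof.
move=> mA mB AB; rewrite -lee_fin -!prE//.
by apply: le_measure => //; rewrite inE.
Qed.

Lemma prT : pr [set: X] = 1.
Proof. by rewrite /pr probability_setT. Qed.

Lemma pr0 : pr set0 = 0.
Proof. by rewrite /pr measure0. Qed.

Lemma pr_le1 A : measurable A -> pr A <= 1.
Proof. by move=> mA; rewrite -prT; apply: pr_le. Qed.

Lemma prU A B : measurable A -> measurable B -> A `&` B = set0 ->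
  pr (A `|` B) = pr A + pr B.
Proof.
move=> mA mB AB; apply: EFin_inj; rewrite EFinD -!prE//; last exact: measurableU.
by rewrite measureU.
Qed.

Lemma prID A B : measurable A -> measurable B ->
  pr A = pr (A `&` B) + pr (A `\` B).
Proof.
move=> mA mB; rewrite -prU ?setUIDK//; first exact: measurableI.
  exact: measurableD.
by apply/seteqP; split=> x //= -[[_ Bx] [_ /(_ Bx)]].
Qed.

Lemma prC A : measurable A -> pr (~` A) = 1 - pr A.
Proof.
move=> mA; rewrite -prT (prID measurableT mA) setTI setTD.
by rewrite [X in X - _]addrC addrK.
Qed.

Lemma prU_le A B : measurable A -> measurable B -> pr (A `|` B) <= pr A + pr B.
Proof.
move=> mA mB; rewrite -lee_fin EFinD -!prE//; last exact: measurableU.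
exact: measureU2.
Qed.

Lemma pr_le2 A B C : measurable A -> measurable B -> measurable C ->
  A `<=` B `|` C -> pr A <= pr B + pr C.
Proof.
move=> mA mB mC ABC; apply: (le_trans _ (prU_le mB mC)).
by apply: pr_le => //; apply: measurableU.
Qed.

Lemma pr_bigcup_le (A : nat -> set X) (r : R) :
  (forall i, measurable (A i)) ->
  (forall n, \sum_(0 <= i < n) pr (A i) <= r) -> pr (\bigcup_i A i) <= r.
Proof.
move=> mA h; rewrite -lee_fin -prE; last exact: bigcupT_measurable.
apply: (le_trans (generalized_Boole_inequality _ mA _)).
  exact: bigcupT_measurable.
apply: lime_le; first exact: is_cvg_nneseries.
apply: nearW => n; rewrite (eq_bigr (fun i => (pr (A i))%:E)) => [|i _]; last exact: prE.
by rewrite sumEFin lee_fin.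
Qed.

Lemma pr_bigcap_cvg (A : nat -> set X) :
  (forall i, measurable (A i)) -> (forall i j, (i <= j)%N -> A j `<=` A i) ->
  forall e, 0 < e -> exists n, pr (A n) <= pr (\bigcap_i A i) + e.
Proof.
move=> mA dA e e0.
have mI : measurable (\bigcap_i A i) by exact: bigcapT_measurable.
have A0 : (mu (A 0%N) < +oo)%E by rewrite prE// ltry.
have nA : nonincreasing_seq A by move=> i j ij; apply/subsetPset/dA.
have := nonincreasing_cvg_mu A0 mA mI nA.
rewrite /= prE// => /fine_cvgP[_].
move=> /cvgrPdist_lt /(_ _ e0)[n _ /(_ n (leqnn _))] /=.
rewrite -/(pr (A n)) => h; exists n.
by rewrite ltr_distlC in h; case/andP: h => _ /ltW.
Qed.

Lemma measurable_fiber_mem (I : finType) (Z : X -> I) (P : pred I) :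
  (forall i, measurable (Z @^-1` [set i])) -> measurable (Z @^-1` [set i | P i]).
Proof.
move=> mZ; rewrite (_ : _ @^-1` _ = \bigcup_(i in [set i | P i]) Z @^-1` [set i]).
  by apply: fin_bigcup_measurable => // i _; exact: mZ.
by apply/seteqP; split=> [x Px|x [i Pi /= ->]//]; exists (Z x).
Qed.

Lemma pr_total_cond (I : finType) (P : pred I) (Z : X -> I) (A : set X) :
  (forall i, measurable (Z @^-1` [set i])) -> measurable A ->
  pr (A `&` Z @^-1` [set i | P i]) = \sum_(i | P i) pr (A `&` Z @^-1` [set i]).
Proof.
move=> mZ mA; rewrite -big_filter.
have -> : A `&` Z @^-1` [set i | P i] =
    A `&` Z @^-1` [set i | i \in [seq i <- index_enum I | P i]].
  by congr (_ `&` _); apply/seteqP; split=> x /=;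
    rewrite mem_filter mem_index_enum andbT.
elim: [seq i <- index_enum I | P i] (filter_uniq P (index_enum_uniq I)) =>
    [_|i s IH /= /andP[i_s us]].
  by rewrite big_nil (_ : _ `&` _ = set0) ?pr0//; apply/seteqP; split=> x // [].
rewrite big_cons -IH// -prU.
- congr pr; apply/seteqP; split=> x /=; rewrite inE.
    by case=> Ax /orP[/eqP|]; [left|right].
  by case=> -[Ax ->]; rewrite ?eqxx ?orbT.
- exact: measurableI.
- by apply: measurableI => //; exact: measurable_fiber_mem.
- apply/seteqP; split=> x //= -[[_ ->]] [_].
  by rewrite (negbTE i_s).
Qed.

Lemma pr_total (I : finType) (Z : X -> I) (A : set X) :
  (forall i, measurable (Z @^-1` [set i])) -> measurable A ->
  pr A = \sum_i pr (A `&` Z @^-1` [set i]).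
Proof.
move=> mZ mA; rewrite -(pr_total_cond xpredT)//; congr pr.
by apply/seteqP; split=> [x|x []].
Qed.

End real_probability.

Section expectation.
Context {R : realType} {d : measure_display} {X : measurableType d}.
Variable mu : probability X R.
Local Notation pr := (pr mu).

(** Under a probability measure such functions are integrable, and they are stable under all the
    operations used below, so integrability need not be tracked separately. *)
Definition bounded_measurable (f : X -> R) : Prop :=
  measurable_fun [set: X] f /\ exists M, forall x, `|f x| <= M.
Local Notation bm := bounded_measurable.

Definition ex (f : X -> R) : R := (\int[mu]_x f x)%R.

Lemma bm_integrable f : bm f -> mu.-integrable [set: X] (EFin \o f).
Proof.
move=> [mf [M fM]]; apply: measurable_bounded_integrable => //.
  exact: (le_lt_trans (probability_le1 mu measurableT) (ltry _)).
exists M; split; first exact: num_real.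
by move=> N MN x _ /=; apply: (le_trans (fM x)); exact: ltW.
Qed.

Lemma exE f : bm f -> (\int[mu]_x (f x)%:E)%E = (ex f)%:E.
Proof.
move=> bf; rewrite /ex /Rintegral fineK//.
by have := integrable_fin_num measurableT (bm_integrable bf).
Qed.

Lemma bm_cst c : bm (fun=> c).
Proof. by split=> //; exists `|c|. Qed.

Lemma bm_indic A : measurable A -> bm (\1_A).
Proof.
move=> mA; split; first exact: measurable_indic.
by exists 1 => x; rewrite indicE; case: (_ \in _); rewrite ?normr1 ?normr0.
Qed.

Lemma bmD f g : bm f -> bm g -> bm (fun x => f x + g x).
Proof.
move=> [mf [M fM]] [mg [N gN]]; split; first exact: measurable_funD.
by exists (M + N) => x; apply: (le_trans (ler_normD _ _)); apply: lerD.
Qed.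

Lemma bmM f g : bm f -> bm g -> bm (fun x => f x * g x).
Proof.
move=> [mf [M fM]] [mg [N gN]]; split; first exact: measurable_funM.
by exists (M * N) => x; rewrite normrM ler_pM.
Qed.

Lemma bmZ c f : bm f -> bm (fun x => c * f x).
Proof. by move=> bf; apply: bmM => //; exact: bm_cst. Qed.

Lemma bmN f : bm f -> bm (fun x => - f x).
Proof.
move=> /(bmZ (-1)) h; rewrite (_ : (fun _ => _) = (fun x => -1 * f x))//.
by apply/funext => x; rewrite mulN1r.
Qed.

Lemma bmB f g : bm f -> bm g -> bm (fun x => f x - g x).
Proof. by move=> bf bg; apply: bmD => //; exact: bmN. Qed.

Lemma bm_norm f : bm f -> bm (fun x => `|f x|).
Proof.
move=> [mf [M fM]]; split; first exact: measurableT_comp.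
by exists M => x; rewrite normr_id.
Qed.

Lemma bm_sum (n : nat) (f : nat -> X -> R) :
  (forall i, bm (f i)) -> bm (fun x => \sum_(0 <= i < n) f i x).
Proof.
move=> bf; elim: n => [|n IH].
  by rewrite (_ : (fun _ => _) = (fun=> 0)) ?funeqE//;
    [exact: bm_cst|move=> x; rewrite big_geq].
rewrite (_ : (fun _ => _) = (fun x => \sum_(0 <= i < n) f i x + f n x)).
  exact: bmD.
by apply/funext => x; rewrite big_nat_recr.
Qed.

Lemma ex_cst c : ex (fun=> c) = c.
Proof. by rewrite /ex Rintegral_cst// [X in fine X]probability_setT mulr1. Qed.

Lemma ex_indic A : measurable A -> ex (\1_A) = pr A.
Proof. by move=> mA; rewrite /ex /Rintegral integral_indic// setIT. Qed.

Lemma exD f g : bm f -> bm g -> ex (fun x => f x + g x) = ex f + ex g.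
Proof. by move=> bf bg; apply: RintegralD => //; exact: bm_integrable. Qed.

Lemma exZ c f : bm f -> ex (fun x => c * f x) = c * ex f.
Proof. by move=> bf; apply: RintegralZl => //; exact: bm_integrable. Qed.

Lemma exB f g : bm f -> bm g -> ex (fun x => f x - g x) = ex f - ex g.
Proof. by move=> bf bg; apply: RintegralB => //; exact: bm_integrable. Qed.

Lemma ex_le f g : bm f -> bm g -> (forall x, f x <= g x) -> ex f <= ex g.
Proof.
by move=> bf bg fg; apply: le_Rintegral => //; exact: bm_integrable.
Qed.

Lemma ex_sum (n : nat) (f : nat -> X -> R) : (forall i, bm (f i)) ->
  ex (fun x => \sum_(0 <= i < n) f i x) = \sum_(0 <= i < n) ex (f i).
Proof.
move=> bf; elim: n => [|n IH].
  rewrite big_geq// -[RHS](ex_cst 0); congr ex; apply/funext => x.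
  by rewrite big_geq.
rewrite big_nat_recr//= -IH -exD//; last exact: bm_sum.
by congr ex; apply/funext => x; rewrite big_nat_recr.
Qed.

End expectation.

(** * The mean ergodic theorem *)

Section averages.
Context {R : realType} {d : measure_display} {X : measurableType d}.
Variables (mu : probability X R) (T : X -> X).
Hypothesis Tmp : measure_preserving mu T.
Local Notation pr := (pr mu).
Local Notation ex := (ex mu).

(** The Birkhoff sum of the indicator, left undivided so that it is additive over consecutive blocks
    of an orbit. *)
Definition visits (C : set X) (n : nat) (x : X) : R :=
  \sum_(0 <= i < n) \1_C (iter i T x).

Lemma measurable_preimage A : measurable A -> measurable (T @^-1` A).
Proof. by move=> mA; rewrite -[X in measurable X]setTI; apply: Tmp.1. Qed.

Lemma measurable_iter i A : measurable A -> measurable (iter i T @^-1` A).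
Proof.
move=> mA; elim: i => [//|i IH].
rewrite (_ : _ @^-1` _ = T @^-1` (iter i T @^-1` A)); first exact: measurable_preimage.
by apply/seteqP; split=> x /=; rewrite -iterSr.
Qed.

Lemma pr_preimage A : measurable A -> pr (T @^-1` A) = pr A.
Proof. by move=> mA; rewrite /pr (Tmp.2 A mA). Qed.

Lemma pr_iter i A : measurable A -> pr (iter i T @^-1` A) = pr A.
Proof.
move=> mA; elim: i => [//|i IH].
rewrite (_ : _ @^-1` _ = T @^-1` (iter i T @^-1` A)).
  by rewrite pr_preimage//; exact: measurable_iter.
by apply/seteqP; split=> x /=; rewrite -iterSr.
Qed.

Lemma indic_iter C i : (fun x => \1_C (iter i T x) : R) = \1_(iter i T @^-1` C).
Proof. by apply/funext => x; rewrite !indicE; congr (_%:R); rewrite !in_setE. Qed.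

Lemma bm_indic_iter C i : measurable C ->
  bounded_measurable (fun x => \1_C (iter i T x) : R).
Proof.
by move=> mC; rewrite indic_iter; apply: bm_indic; exact: measurable_iter.
Qed.

Lemma bm_visits C n : measurable C -> bounded_measurable (visits C n).
Proof. by move=> mC; apply: bm_sum => i; exact: bm_indic_iter. Qed.

Lemma ex_visits C n : measurable C -> ex (visits C n) = n%:R * pr C.
Proof.
move=> mC; rewrite /visits ex_sum => [|i]; last exact: bm_indic_iter.
rewrite (eq_bigr (fun=> pr C)) => [|i _].
  by rewrite sumr_const_nat subn0 mulr_natl.
by rewrite indic_iter ex_indic ?pr_iter//; exact: measurable_iter.
Qed.

Definition deviation (C : set X) (n : nat) : R :=
  ex (fun x => `|n%:R^-1 * visits C n x - pr C|).

Lemma bm_dev C n : measurable C ->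
  bounded_measurable (fun x => n%:R^-1 * visits C n x - pr C).
Proof. by move=> mC; apply: bmB; [apply/bmZ/bm_visits|apply: bm_cst]. Qed.

Lemma ergodic_deviationE C n : measurable C ->
  ergodic_deviation mu T C n = (deviation C n)%:E.
Proof. by move=> mC; rewrite -exE//; exact/bm_norm/bm_dev. Qed.

Lemma visits_ge0 C n x : 0 <= visits C n x.
Proof. by rewrite /visits sumr_ge0. Qed.

Lemma visits_le C n x : visits C n x <= n%:R.
Proof.
rewrite /visits; apply: (le_trans (ler_sum_nat (G := fun=> 1) _)).
  by move=> i _; rewrite indicE lern1 leq_b1.
by rewrite sumr_const_nat subn0.
Qed.

(* A(n) C - A(n) U is dominated by the average of the indicator of the symmetric
   difference, which T preserves. *)
Lemma deviation_perturb C U n : measurable C -> measurable U -> (0 < n)%N ->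
  deviation C n <= deviation U n + 2 * pr (symdiff C U).
Proof.
move=> mC mU n0; have mS : measurable (symdiff C U) by exact: measurable_symdiff.
have n_neq0 : n%:R != 0 :> R by rewrite pnatr_eq0 -lt0n.
have bS := bm_visits n mS; have bU := bm_norm (bm_dev n mU).
have bSn := bmD (bmZ n%:R^-1 bS) (bm_cst (pr (symdiff C U))).
(* The factor 2: [pr (symdiff C U)] bounds the expected difference of the two averages, because [T]
   preserves measure, and also [|pr C - pr U|]. *)
have -> : deviation U n + 2 * pr (symdiff C U) = ex (fun x =>
    `|n%:R^-1 * visits U n x - pr U| +
    (n%:R^-1 * visits (symdiff C U) n x + pr (symdiff C U))).
  rewrite (exD mu bU bSn) (exD mu (bmZ _ bS) (bm_cst _)) (exZ mu _ bS).
  by rewrite ex_visits// ex_cst mulKf// mulr2n mulrDl mul1r.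
apply: ex_le => [||x]; [exact/bm_norm/bm_dev|exact: bmD|].
have pCU : `|pr C - pr U| <= pr (symdiff C U).
  have mCU : measurable (C `\` U) by exact: measurableD.
  have mUC : measurable (U `\` C) by exact: measurableD.
  have disj : (C `\` U) `&` (U `\` C) = set0.
    by apply/seteqP; split=> y //= -[[Cy _] [_ /(_ Cy)]].
  rewrite /symdiff prU//.
  rewrite (prID mu mC mU) (prID mu mU mC) setIC.
  have := pr_ge0 mu (C `\` U); have := pr_ge0 mu (U `\` C).
  by rewrite ler_norml => ? ?; apply/andP; split; lra.
have vCU : `|visits C n x - visits U n x| <= visits (symdiff C U) n x.
  rewrite /visits -sumrB; apply: (le_trans (ler_norm_sum _ _ _)).
  apply: ler_sum => i _; rewrite !indicE /symdiff in_setU !in_setD.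
  by do 2! case: (_ \in _); rewrite /= ?subrr ?normr0 ?sub0r ?subr0 ?normrN ?normr1.
have {vCU} : `|n%:R^-1 * visits C n x - n%:R^-1 * visits U n x| <=
    n%:R^-1 * visits (symdiff C U) n x.
  by rewrite -mulrBr normrM ger0_norm ?invr_ge0// ler_wpM2l ?invr_ge0.
move: pCU; set a := _ * visits C n x; set b := _ * visits U n x.
have -> : a - pr C = (b - pr U) + ((a - b) - (pr C - pr U)) by lra.
move=> h1 h2; apply: (le_trans (ler_normD _ _)); rewrite lerD2l.
by apply: (le_trans (ler_normB _ _)); exact: lerD.
Qed.

Lemma visits_add C n m x :
  visits C (n + m) x = visits C n x + visits C m (iter n T x).
Proof.
rewrite /visits (@big_cat_nat _ _ _ n)//= ?leq_addr//; congr (_ + _).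
rewrite -{1}(add0n n) big_addn addKn; apply: eq_bigr => i _.
by rewrite iterD.
Qed.

Lemma visits_succ C n x : visits C n.+1 x = \1_C x + visits C n (T x).
Proof. by rewrite -add1n visits_add /visits big_nat1. Qed.

End averages.

Section level_sets.
Context {R : realType} {d : measure_display} {X : measurableType d}.
Implicit Types f g : X -> R.

Lemma measurable_ge f a : measurable_fun [set: X] f ->
  measurable [set x | a <= f x].
Proof.
move=> mf; rewrite (_ : [set _ | _] = [set: X] `&` f @^-1` `[a, +oo[%classic).
  exact: mf.
by apply/seteqP; split=> x /=; rewrite in_itv/= andbT => // -[].
Qed.

Lemma measurable_gt f a : measurable_fun [set: X] f ->
  measurable [set x | a < f x].
Proof.
move=> mf; rewrite (_ : [set _ | _] = [set: X] `&` f @^-1` `]a, +oo[%classic).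
  exact: mf.
by apply/seteqP; split=> x /=; rewrite in_itv/= andbT => // -[].
Qed.

Lemma measurable_le f a : measurable_fun [set: X] f ->
  measurable [set x | f x <= a].
Proof.
move=> mf; rewrite (_ : [set _ | _] = ~` [set x | a < f x]).
  by apply: measurableC; exact: measurable_gt.
by apply/seteqP; split=> x /=; rewrite leNgt => /negP.
Qed.

Lemma measurable_lt f a : measurable_fun [set: X] f ->
  measurable [set x | f x < a].
Proof.
move=> mf; rewrite (_ : [set _ | _] = ~` [set x | a <= f x]).
  by apply: measurableC; exact: measurable_ge.
by apply/seteqP; split=> x /=; rewrite ltNge => /negP.
Qed.

End level_sets.

Lemma archimedean_bound (R : realType) (a b : R) : 0 < b ->
  exists n : nat, a <= n%:R * b.
Proof.
move=> b0; exists (Num.bound `|a / b|); rewrite -ler_pdivrMr//.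
by apply: (le_trans (ler_norm _)); apply: ltW; exact: archi_boundP.
Qed.

Section mean_ergodic.
Context {R : realType} {d : measure_display} {X : measurableType d}.
Variables (mu : probability X R) (T : X -> X) (U : set X).
Hypothesis Tmp : measure_preserving mu T.
Hypothesis mU : measurable U.
Local Notation pr := (pr mu).
Local Notation vis := (@visits R d X T U).

(** Building block of [upper_average_ge c], the set where the limsup of [vis n x / n] is at least
    [c]; only countable operations occur, so measurability is immediate. *)
Definition often (c : R) (m n : nat) : set X :=
  \bigcup_k [set x | (n + k)%:R * (c - m.+1%:R^-1) <= vis (n + k) x].

Definition upper_average_ge (c : R) : set X := \bigcap_m \bigcap_n often c m n.

Lemma mvisits n : measurable_fun [set: X] (vis n).
Proof. by have [] := bm_visits Tmp n mU. Qed.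

Lemma measurable_often c m n : measurable (often c m n).
Proof. by apply: bigcupT_measurable => k; exact/measurable_ge/mvisits. Qed.

Lemma measurable_upper_average_ge c : measurable (upper_average_ge c).
Proof. by do 2 apply: bigcapT_measurable => ?; exact: measurable_often. Qed.

Lemma upper_average_geP c x : upper_average_ge c x <->
  forall e N, 0 < e -> exists2 n, (N <= n)%N & n%:R * (c - e) <= vis n x.
Proof.
split=> [h e N e0|h m _ N _].
  have [m me] := archimedean_bound 1 e0.
  have [k _ /= hk] := h m I N I.
  exists (N + k)%N; first exact: leq_addr.
  apply: le_trans hk; rewrite ler_wpM2l// lerD2l lerN2.
  have m0 : (0 : R) < m.+1%:R by [].
  rewrite -[_^-1]mul1r ler_pdivrMr//; apply: (le_trans me).
  by rewrite (mulrC e) ler_wpM2r ?ler_nat// ltW.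
have [n Nn hn] := h m.+1%:R^-1 N ltac:(by rewrite invr_gt0).
by exists (n - N)%N => //=; rewrite subnKC.
Qed.

(** Moving the start of the orbit by one step changes a count by at most 1, which half of the
    tolerance absorbs once [n * (e / 2)] is large. The invariance is exact, as [ergodic]
    requires. *)
Lemma upper_average_ge_invariant c :
  T @^-1` upper_average_ge c = upper_average_ge c.
Proof.
apply/seteqP; split=> x /=; rewrite !upper_average_geP => h e N e0;
    have e20 : 0 < e / 2 by rewrite divr_gt0.
- have [K hK] := archimedean_bound (c - e) e20.
  have [n Nn hn] := h (e / 2) (maxn N K) e20.
  exists n.+1; first by apply: leqW; apply: leq_trans Nn; rewrite leq_maxl.
  rewrite visits_succ; apply: (le_trans _ (lerD (ler0n _ _) hn)).
  have : K%:R * (e / 2) <= n%:R * (e / 2).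
    apply: ler_wpM2r; first exact: ltW.
    by rewrite ler_nat; apply: leq_trans Nn; rewrite leq_maxr.
  by rewrite add0r -[n.+1%:R]natr1; lra.
- have [K hK] := archimedean_bound (1 - c + e / 2) e20.
  have [[//|n] Nn hn] := h (e / 2) (maxn N K).+1 e20.
  rewrite ltnS in Nn; exists n; first by apply: leq_trans Nn; rewrite leq_maxl.
  rewrite visits_succ in hn.
  have u1 : (\1_U x : R) <= 1 by rewrite indicE lern1 leq_b1.
  have : K%:R * (e / 2) <= n%:R * (e / 2).
    apply: ler_wpM2r; first exact: ltW.
    by rewrite ler_nat; apply: leq_trans Nn; rewrite leq_maxr.
  by move: hn; rewrite -[n.+1%:R]natr1; lra.
Qed.

(* Katznelson-Weiss: cut the orbit into visited blocks and points of B. *)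
Lemma visits_cover (c : R) (M : nat) (B : set X) : 0 <= c ->
  (forall x, B x \/ exists2 n, (n < M)%N & n.+1%:R * c <= vis n.+1 x) ->
  forall L x, c * (L%:R - M%:R) <= vis L x + c * visits T B L x.
Proof.
move=> c0 hB L; have [k] := ubnP L; elim: k L => // k IH L Lk x.
have vge0 V n y : (0 : R) <= visits T V n y by exact: visits_ge0.
(* The loss [c * M] accounts for the final stretch of the orbit, which may be too short for another
   block. *)
have [LM|ML] := leqP L M.
  apply: (@le_trans _ _ 0); last by rewrite addr_ge0 ?mulr_ge0.
  by rewrite mulr_ge0_le0// subr_le0 ler_nat.
case: L => // L in Lk ML *; have [Bx|[n nM hn]] := hB x.
  rewrite !visits_succ; have := IH L Lk (T x).
  have -> : \1_B x = 1 :> R by rewrite indicE mem_set.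
  have : 0 <= \1_U x :> R by [].
  by rewrite -[L.+1%:R]natr1 !mulrDr; lra.
have nL : (n < L.+1)%N by exact: ltn_trans ML.
have -> : L.+1 = (n.+1 + (L - n))%N by rewrite addSn subnKC.
rewrite !visits_add.
have := IH (L - n)%N _ (iter n.+1 T x).
have := vge0 B n.+1 x; rewrite natrD => v0 IHL.
have {IHL} := IHL (leq_ltn_trans (leq_subr _ _) (Lk : (L < k)%N)).
by have := mulr_ge0 c0 v0; rewrite !mulrDr; lra.
Qed.

(** Almost every point starts a block with visit frequency at least [c']; outside the small set
    [B M] a block of length at most [M] will do. Integrating [visits_cover] over long orbits then
    gives the bound. *)
Lemma upper_average_ge_full c c' : 0 <= c' -> c' < c ->
  pr (upper_average_ge c) = 1 -> c' <= pr U.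
Proof.
move=> c'0 c'c W1.
pose B M := \bigcap_n [set x | (n < M)%N -> vis n.+1 x < n.+1%:R * c'].
have mB M : measurable (B M).
  apply: bigcapT_measurable => n; have [nM|_] := ltnP n M; last first.
    by rewrite (_ : [set _ | _] = setT)//; apply/seteqP; split.
  rewrite (_ : [set _ | _] = [set x | vis n.+1 x < n.+1%:R * c']).
    exact/measurable_lt/mvisits.
  by apply/seteqP; split=> x //=; exact.
have dB i j : (i <= j)%N -> B j `<=` B i.
  by move=> ij x Bx n _ /= ni; apply: Bx => //; exact: leq_trans ij.
have B0 : pr (\bigcap_M B M) = 0.
  apply/eqP; rewrite eq_le pr_ge0 andbT.
  have mW := measurable_upper_average_ge c.
  rewrite -(subrr (1 : R)) -{2}W1 -prC//.
  apply: pr_le; [exact: bigcapT_measurable|exact: measurableC|].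
  move=> x Bx /upper_average_geP /(_ (c - c') 1%N).
  rewrite subr_gt0 => /(_ c'c)[[//|n] _].
  rewrite subKr leNgt => /negP; apply.
  by have := Bx n.+1 I n I; exact.
apply/ler_addgt0Pr => e e0.
(* Chosen so that [c' * r <= e]; the added 1 covers the case [c' = 0]. *)
pose r := e / (c' + 1).
have r0 : 0 < r by rewrite divr_gt0// ltr_wpDl.
have [M] := pr_bigcap_cvg mu mB dB r0; rewrite B0 add0r => BM.
have cB : c' * pr (B M) <= e.
  apply: (@le_trans _ _ ((c' + 1) * r)).
    by apply: ler_pM => //; [exact: pr_ge0|rewrite lerDl].
  by rewrite mulrC divfK// gt_eqF// ltr_wpDl.
apply: (@le_trans _ _ (pr U + c' * pr (B M))); last by rewrite lerD2l.
(* A positive gap would grow linearly in [L], whereas the integrated covering inequality bounds [L]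
   times the gap by [c' * M]. *)
rewrite leNgt; apply/negP; rewrite -subr_gt0 => gap.
have [L hL] := archimedean_bound (c' * M%:R + 1) gap.
have h x : c' * (L%:R - M%:R) <= vis L x + c' * visits T (B M) L x.
  apply: visits_cover => // y.
  have [|/existsNP[n /not_implyP[_ /= /not_implyP[nM /negP]]]] := pselect (B M y).
    by left.
  by rewrite -leNgt => ?; right; exists n.
have bU := bm_visits Tmp L mU; have bV := bm_visits Tmp L (mB M).
have bB := bmZ c' bV.
have := ex_le mu (bm_cst _) (bmD bU bB) h.
rewrite ex_cst (exD mu bU bB) (exZ mu _ bV) !ex_visits//.
by move: hL; rewrite !mulrBr !mulrDr; lra.
Qed.

Hypothesis Terg : ergodic mu T.

(** By ergodicity the measure is 0 or 1, and 1 would force [pr U] to be at least the midpoint of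
    [pr U] and [c]. *)
Lemma upper_average_ge_null c : pr U < c -> pr (upper_average_ge c) = 0.
Proof.
move=> Uc; set W := upper_average_ge c.
have mW : measurable W by exact: measurable_upper_average_ge.
have [W0|W1] := Terg mW (upper_average_ge_invariant c); first by rewrite /pr W0.
have p0 := pr_ge0 mu U.
have := @upper_average_ge_full c ((c + pr U) / 2) ltac:(lra) ltac:(lra).
by rewrite -/W {1}/pr W1 => /(_ erefl); lra.
Qed.

(** An upper bound on the averages suffices: if [f <= g] and [0 <= g] then [|f| <= 2 * g - f], and
    here [f], the centred average, has mean zero. *)
Lemma mean_ergodic e : 0 < e ->
  exists N, forall n, (N <= n)%N -> deviation mu T U n <= e.
Proof.
(* The final bound is [2 * (2 * a + pr (V N))] with [pr (V N) <= a], that is [6 * a]. *)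
move=> e0; pose a := e / 6; have a0 : 0 < a by rewrite divr_gt0.
pose c := pr U + 2 * a.
(* Points whose average reaches [c] at some time from [N] on; these sets decrease to a subset of the
   null set [upper_average_ge c]. *)
pose V N := \bigcup_k [set x | (N + k)%:R * c <= vis (N + k) x].
have mV N : measurable (V N).
  by apply: bigcupT_measurable => k; exact/measurable_ge/mvisits.
have dV i j : (i <= j)%N -> V j `<=` V i.
  move=> ij x [k _ hk]; exists (j - i + k)%N => //=.
  by rewrite addnA subnKC.
have V0 : pr (\bigcap_N V N) = 0.
  apply/eqP; rewrite eq_le pr_ge0 andbT.
  rewrite -(@upper_average_ge_null c); last by rewrite /c; lra.
  apply: pr_le; [exact: bigcapT_measurable|exact: measurable_upper_average_ge|].
  move=> x Vx; apply/upper_average_geP => r N r0.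
  have [k _ hk] := Vx N I; exists (N + k)%N; first exact: leq_addr.
  by apply: le_trans hk; rewrite ler_wpM2l// gerBl ltW.
have [N] := pr_bigcap_cvg mu mV dV a0; rewrite V0 add0r => VN.
exists N.+1 => n Nn; have n0 : (0 < n)%N by exact: leq_trans Nn.
have n0R : (0 : R) < n%:R by rewrite ltr0n.
have bd := bm_dev Tmp n mU; have bV := bm_indic (R := R) (mV N).
have bb := bmD (bm_cst (2 * a)) bV.
apply: (@le_trans _ _ (ex mu (fun x =>
    2 * (2 * a + \1_(V N) x) - (n%:R^-1 * vis n x - pr U)))).
  apply: ex_le => [||x]; [exact: bm_norm|by apply: bmB => //; exact: bmZ|].
  suff : n%:R^-1 * vis n x - pr U <= 2 * a + \1_(V N) x.
    have : 0 <= \1_(V N) x :> R by [].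
    by move=> ? ?; rewrite ler_norml; apply/andP; split; lra.
  have vn : vis n x <= n%:R by exact: visits_le.
  have [Vx|Vx] := pselect (V N x).
    rewrite indicE mem_set//; apply: (@le_trans _ _ 1); last first.
      by rewrite lerDr mulr_ge0// ltW.
    apply: (@le_trans _ _ (n%:R^-1 * vis n x)); first by rewrite gerBl pr_ge0.
    by rewrite mulrC ler_pdivrMr// mul1r.
  rewrite indicE memNset// addr0 lerBlDl mulrC ler_pdivrMr//.
  rewrite leNgt; apply/negP => /ltW h; apply: Vx; exists (n - N)%N => //=.
  by rewrite subnKC ?(ltnW Nn)// mulrC.
rewrite exB//; last exact: bmZ.
rewrite exZ// exD//; last exact: bm_cst.
rewrite ex_cst ex_indic//.
have bU := bm_visits Tmp n mU.
rewrite (exB mu (bmZ _ bU) (bm_cst _)) (exZ mu _ bU) ex_visits//.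
rewrite ex_cst mulKf ?gt_eqF// subrr subr0.
by move: VN; rewrite /a; lra.
Qed.

End mean_ergodic.

Lemma asbool_eqP (P : Prop) (b : bool) : `[< P >] = b <-> if b then P else ~ P.
Proof. by case: asboolP; case: b. Qed.

(** * Entropy and total boundedness *)

Section limn_einf_bounds.
Variable R : realType.
Implicit Types (u : (\bar R)^nat) (c : \bar R).

Lemma limn_einf_ge u c N : (forall n, (N <= n)%N -> (c <= u n)%E) ->
  (c <= limn_einf u)%E.
Proof.
move=> h; rewrite limn_einf_lim; apply: lime_ge; first exact: is_cvg_einfs.
near=> n; apply: le_ereal_inf_tmp => _ [m /= nm <-]; apply: h.
by apply: leq_trans nm; near: n; exists N.
Unshelve. all: by end_near. Qed.

Lemma limn_einf_le u c N : (forall n, (N <= n)%N -> (u n <= c)%E) ->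
  (limn_einf u <= c)%E.
Proof.
move=> h; rewrite limn_einf_lim; apply: lime_le; first exact: is_cvg_einfs.
near=> n; apply: (@le_trans _ _ (u n)).
  by apply: ereal_inf_lbound; exists n => /=.
by apply: h; near: n; exists N.
Unshelve. all: by end_near. Qed.

End limn_einf_bounds.

Section entropy_inequalities.
Variable R : realType.
Implicit Types a b p q : R.

Lemma ln_le_subr1 a : 0 < a -> ln a <= a - 1.
Proof. by move=> a0; rewrite -{1}(subrK 1 a) addrC; apply: le_ln1Dx; lra. Qed.

(** Cutting a cell into masses [a] and [b] gains at least the smaller mass in entropy:
    [ln x <= x - 1] bounds the gain below by [2 * a * b / (a + b)], and the larger mass is at least
    half of the sum. *)
Lemma xlnx_split a b : 0 <= a -> 0 <= b ->
  a * ln a + b * ln b <= (a + b) * ln (a + b) - Num.min a b.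
Proof.
rewrite le_eqVlt => /predU1P[<- b0|a0].
  by rewrite mul0r !add0r min_l// subr0.
rewrite le_eqVlt => /predU1P[<-|b0].
  by rewrite mul0r !addr0 min_r ?subr0// ltW.
have s0 : 0 < a + b by exact: addr_gt0.
have key x : 0 < x -> x * ln x <= x * ln (a + b) + x * (x / (a + b) - 1).
  move=> x0; rewrite -mulrDr ler_pM2l// -lerBlDl -ln_div ?posrE//.
  by apply: ln_le_subr1; exact: divr_gt0.
apply: (le_trans (lerD (key a a0) (key b b0))).
suff : Num.min a b <= a * (1 - a / (a + b)) + b * (1 - b / (a + b)).
  by rewrite !mulrDl !mulrDr !mulrN; lra.
have -> : a * (1 - a / (a + b)) + b * (1 - b / (a + b)) = 2 * a * b / (a + b).
  by field; rewrite gt_eqF.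
rewrite ler_pdivlMr//; have [ab|/ltW ab] := leP a b.
  suff : 0 <= a * (b - a) by lra.
  by apply: mulr_ge0; rewrite ?subr_ge0// ltW.
suff : 0 <= b * (a - b) by lra.
by apply: mulr_ge0; rewrite ?subr_ge0// ltW.
Qed.

(** One term of Gibbs' inequality, with the logarithm of [p] replaced by that of a marginal [r]
    dominating [p]. *)
Lemma gibbs_term p q r : 0 <= p <= r -> 0 < q ->
  p * (ln q - ln r) <= q - p.
Proof.
move=> /andP[]; rewrite le_eqVlt => /predU1P[<- _|p0 pr q0].
  by rewrite mul0r subr0 => /ltW.
have r0 : 0 < r by exact: lt_le_trans pr.
rewrite -ln_div ?posrE//.
apply: (@le_trans _ _ (p * (q / r - 1))).
  by rewrite ler_pM2l//; apply: ln_le_subr1; exact: divr_gt0.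
rewrite mulrBr mulr1 lerD2r mulrCA ler_piMr//; first exact: ltW.
by rewrite ler_pdivrMr// mul1r.
Qed.

End entropy_inequalities.

Section entropy.
Context {R : realType} {d : measure_display} {X : measurableType d}.
Variable mu : probability X R.
Local Notation pr := (pr mu).

(** Entropy to base e of the partition into fibres of [Z]; with partitions encoded as maps, joining
    them is pairing the maps. *)
Definition natural_entropy (I : finType) (Z : X -> I) : R :=
  - \sum_i pr (Z @^-1` [set i]) * ln (pr (Z @^-1` [set i])).

Lemma natural_entropy_comp (I J : finType) (Z : X -> I) (f : I -> J) :
  bijective f -> natural_entropy (f \o Z) = natural_entropy Z.
Proof.
move=> bf; rewrite /natural_entropy (reindex f); last exact: onW_bij.
congr (- _); apply: eq_bigr => i _.
suff -> : (f \o Z) @^-1` [set f i] = Z @^-1` [set i] by [].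
apply/seteqP; split=> x /=; first by move/(bij_inj bf).
by move=> ->.
Qed.

Lemma natural_entropy_pair (I : finType) (Z : X -> I) (D : set X) :
  (forall i, measurable (Z @^-1` [set i])) -> measurable D ->
  natural_entropy Z + \sum_i Num.min (pr (Z @^-1` [set i] `&` D))
                                     (pr (Z @^-1` [set i] `\` D)) <=
  natural_entropy (fun x => (Z x, `[< D x >])).
Proof.
move=> mZ mD; rewrite /natural_entropy.
pose G i c := if c then pr (Z @^-1` [set i] `&` D) else pr (Z @^-1` [set i] `\` D).
rewrite [X in _ <= - X](eq_bigr (fun v => G v.1 v.2 * ln (G v.1 v.2))); last first.
  move=> [i c] _; suff -> : (fun x => (Z x, `[< D x >])) @^-1` [set (i, c)] =
      if c then Z @^-1` [set i] `&` D else Z @^-1` [set i] `\` D.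
    by rewrite /G; case: c.
  apply/seteqP; split=> x /=.
    by case=> <- /asbool_eqP; case: c.
  by case: c => -[-> Dx]; congr pair; exact/asbool_eqP.
rewrite -(pair_bigA _ (fun i c => G i c * ln (G i c)))/= -sumrN -big_split -sumrN.
apply: ler_sum => i _; rewrite big_bool /G/=.
have := xlnx_split (pr_ge0 mu (Z @^-1` [set i] `&` D))
  (pr_ge0 mu (Z @^-1` [set i] `\` D)).
by rewrite -(prID mu (mZ i) mD); lra.
Qed.

(** The centres of the net may be any measurable sets, not only members of [F]; this lets unions of
    cells serve as centres. *)
Definition totally_bounded (F : set (set X)) : Prop :=
  forall e, 0 < e -> exists (I : finType) (U : I -> set X),
    (forall i, measurable (U i)) /\
    forall C, F C -> exists i, pr (symdiff C (U i)) <= e.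

Lemma not_totally_bounded_nonempty (F : set (set X)) :
  ~ totally_bounded F -> F !=set0.
Proof.
move=> ntb; apply/set0P/negP => /eqP F0; apply: ntb; rewrite F0 => e e0.
by exists unit, (fun=> set0); split=> // _; exact: measurable0.
Qed.

(* The net consists of the unions of fibres of Z. *)
Lemma not_totally_bounded (F : set (set X)) :
  (forall C, F C -> measurable C) -> ~ totally_bounded F ->
  exists2 e, 0 < e & forall (I : finType) (Z : X -> I),
    (forall i, measurable (Z @^-1` [set i])) ->
    exists2 C, F C & e <= \sum_i Num.min (pr (Z @^-1` [set i] `&` C))
                                         (pr (Z @^-1` [set i] `\` C)).
Proof.
move=> mF /existsNP[e /not_implyP[e0 ntb]]; exists e => // I Z mZ.
apply: contrapT => hC; apply: ntb.
pose U (S : {ffun I -> bool}) := Z @^-1` [set i | S i].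
have mU S : measurable (U S) by exact: measurable_fiber_mem.
exists {ffun I -> bool}, U; split=> // C FC; have mC := mF _ FC.
(* Taking the fibres at least half filled by [C] leaves an error equal to the smaller of the two
   masses in each fibre. *)
pose S := [ffun i => pr (Z @^-1` [set i] `\` C) <= pr (Z @^-1` [set i] `&` C)].
exists S; rewrite leNgt; apply/negP => /ltW eS; apply: hC; exists C => //.
apply: (le_trans eS); rewrite (pr_total mu mZ); last exact: measurable_symdiff.
apply: ler_sum => i _; rewrite le_min.
have -> : symdiff C (U S) `&` Z @^-1` [set i] =
    if S i then Z @^-1` [set i] `\` C else Z @^-1` [set i] `&` C.
  rewrite /symdiff /U; case: ifPn => [iS|/negP iS]; apply/seteqP; split=> x /=.
  - by case=> + Zx; rewrite Zx => -[[_ /(_ iS)]|[]].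
  - by case=> Zx Cx; split=> //; right; rewrite Zx.
  - by case=> + Zx; rewrite Zx => -[[]|[/iS]].
  - by case=> Zx Cx; split=> //; left; rewrite Zx.
rewrite ffunE; case: ifPn => [h|]; first by rewrite h lexx.
by rewrite -ltNge => /ltW ->; rewrite lexx.
Qed.

Variable C : nat -> set X.
Hypothesis mC : forall i, measurable (C i).

Definition join_label (n : nat) (x : X) : {ffun 'I_n -> bool} :=
  [ffun i : 'I_n => `[< C i x >]].

Lemma join_cellE n b : join_cell C b = join_label n @^-1` [set b].
Proof.
rewrite /join_cell /join_label; apply/seteqP; split=> x /=.
  move=> h; apply/ffunP => i; rewrite ffunE; apply/asbool_eqP.
  by have := h i I; case: (b i).
by move=> <- i _; rewrite ffunE; case: asboolP.
Qed.

Lemma measurable_join_label n b : measurable (join_label n @^-1` [set b]).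
Proof.
rewrite -join_cellE; apply: fin_bigcap_measurable => // i _.
by case: ifP => _ //; exact: measurableC.
Qed.

Lemma partition_entropyE n :
  partition_entropy mu (join_cell C (n := n)) =
  natural_entropy (join_label n) / ln 2.
Proof.
rewrite /partition_entropy /natural_entropy mulNr mulr_suml; congr (- _).
by apply: eq_bigr => b _; rewrite join_cellE mulrA.
Qed.

Lemma natural_entropy_ge0 (I : finType) (Z : X -> I) :
  (forall i, measurable (Z @^-1` [set i])) -> 0 <= natural_entropy Z.
Proof.
move=> mZ; rewrite oppr_ge0 sumr_le0// => i _.
by rewrite mulr_ge0_le0 ?pr_ge0// ln_le0// pr_le1.
Qed.

Lemma natural_entropy_succ n :
  natural_entropy (join_label n) +
    \sum_b Num.min (pr (join_label n @^-1` [set b] `&` C n))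
                   (pr (join_label n @^-1` [set b] `\` C n)) <=
  natural_entropy (join_label n.+1).
Proof.
(* [f] and its inverse [g] identify a label of length [n.+1] with its first [n] bits and its last
   bit. *)
pose f (v : {ffun 'I_n -> bool} * bool) : {ffun 'I_n.+1 -> bool} :=
  [ffun i => if unlift ord_max i is Some j then v.1 j else v.2].
pose g (w : {ffun 'I_n.+1 -> bool}) := ([ffun j => w (lift ord_max j)], w ord_max).
have bf : bijective f.
  exists g => [[v c]|w].
    rewrite /g /f; congr pair; last by rewrite ffunE unlift_none.
    by apply/ffunP => j; rewrite !ffunE liftK.
  apply/ffunP => i; rewrite /f ffunE /g/=.
  by case: unliftP => [j ->|->]; rewrite ?ffunE.
have -> : join_label n.+1 = f \o (fun x => (join_label n x, `[< C n x >])).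
  apply/funext => x; apply/ffunP => i; rewrite /f /= !ffunE /=.
  by case: unliftP => [j ->|->//]; rewrite ffunE lift_max.
rewrite natural_entropy_comp//; apply: natural_entropy_pair => //.
exact: measurable_join_label.
Qed.

(* Gibbs' inequality against the law under which the cell of the net is uniform
   and each C i then independently disagrees with its net element with
   probability t. *)
Lemma natural_entropy_net (I : finType) (U : I -> set X) (k : nat -> I) (t e : R) :
  (forall i, measurable (U i)) -> (forall i, pr (symdiff (C i) (U (k i))) <= e) ->
  0 < t < 1 -> forall n, natural_entropy (join_label n) <=
    ln (#|{ffun I -> bool}|%:R) + n%:R * (- ln (1 - t) - e * ln t).
Proof.
move=> mU CU /andP[t0 t1] n.
have lnt0 : ln t <= 0 by rewrite ln_le0// ltW.
have t1' : 0 < 1 - t by lra.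
set K := #|{ffun I -> bool}|%:R.
have K0 : 0 < K :> R.
  by rewrite ltr0n; apply/card_gt0P; exists [ffun=> true].
pose label x : {ffun I -> bool} := [ffun i => `[< U i x >]].
pose V x := (label x, join_label n x).
pose mismatch (v : {ffun I -> bool} * {ffun 'I_n -> bool}) (j : 'I_n) :=
  v.2 j != v.1 (k j).
pose q v := K^-1 * \prod_(j < n) if mismatch v j then t else 1 - t.
have w0 v j : 0 < (if mismatch v j then t else 1 - t) by case: ifP.
have q0 v : 0 < q v by rewrite mulr_gt0 ?invr_gt0// prodr_gt0.
have lnq v : ln (q v) = - ln K +
    \sum_(j < n) ln (if mismatch v j then t else 1 - t).
  rewrite /q lnM ?posrE ?invr_gt0//; last by rewrite prodr_gt0.
  rewrite lnV ?posrE//; congr (_ + _).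
  apply: expR_inj; rewrite lnK ?posrE ?prodr_gt0// expR_sum.
  by apply: eq_bigr => j _; rewrite lnK// posrE.
have sumq : \sum_v q v = 1.
  rewrite (eq_bigr (fun v => q (v.1, v.2))) => [|[]//].
  rewrite -(pair_bigA _ (fun a b => q (a, b)))/= (eq_bigr (fun=> K^-1)).
    by rewrite sumr_const -[LHS]mulr_natl mulfV// gt_eqF.
  move=> a _; rewrite /q -mulr_sumr/=.
  rewrite -(bigA_distr_bigA (fun (j : 'I_n) (c : bool) =>
    if c != a (k j) then t else 1 - t)).
  rewrite big1 ?mulr1// => j _; rewrite big_bool.
  by case: (a _) => /=; rewrite ?subrK// addrC subrK.
have mV v : measurable (V @^-1` [set v]).
  case: v => a b; rewrite (_ : _ @^-1` _ =
      (\bigcap_i (if a i then U i else ~` U i)) `&` join_label n @^-1` [set b]).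
    apply: measurableI; last exact: measurable_join_label.
    apply: fin_bigcap_measurable; first exact: finite_finset.
    move=> i _; case: ifP => _ //.
    exact: measurableC.
  apply/seteqP; split=> x /=; rewrite /V.
    by case=> <- <-; split=> // i _; rewrite ffunE; case: asboolP.
  case=> h ->; congr pair; apply/ffunP => i; rewrite ffunE; apply/asbool_eqP.
  by have := h i Logic.I; case: (a i).
pose p v := pr (V @^-1` [set v]).
pose pb b := pr (join_label n @^-1` [set b]).
have sump : \sum_v p v = 1.
  rewrite -(prT mu) (pr_total mu mV measurableT).
  by apply: eq_bigr => v _; rewrite setTI.
have sumpb b : \sum_a p (a, b) = pb b.
  have mjb := measurable_join_label b.
  rewrite /pb (@pr_total _ _ _ mu _ label)//; last first.
    move=> a; rewrite (_ : _ @^-1` _ = \bigcup_b V @^-1` [set (a, b)]).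
      by apply: fin_bigcup_measurable => // ? _; exact: mV.
    by apply/seteqP; split=> x /=; [move=> <-; exists (join_label n x)|case=> ? _ []].
  apply: eq_bigr => a _; congr pr; apply/seteqP; split=> x /=; rewrite /V.
    by case=> <- <-.
  by case=> -> ->.
(* Comparing [q] with the marginal [pb] instead of [p] bounds the entropy of the join directly,
   without the entropy of the joint variable [V]. *)
have gibbs : \sum_v p v * (ln (q v) - ln (pb v.2)) <= 0.
  apply: (@le_trans _ _ (\sum_v (q v - p v))); last first.
    by rewrite sumrB sumq sump subrr.
  apply: ler_sum => v _.
  apply: gibbs_term => //; rewrite pr_ge0/= -(sumpb v.2) (bigD1 v.1)//=.
  by rewrite -surjective_pairing lerDl sumr_ge0// => ? _; exact: pr_ge0.
have entE : natural_entropy (join_label n) = - \sum_v p v * ln (pb v.2).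
  rewrite /natural_entropy; congr (- _).
  rewrite [RHS](eq_bigr (fun v => p (v.1, v.2) * ln (pb v.2))) => [|[]//].
  rewrite -(pair_bigA _ (fun a b => p (a, b) * ln (pb b)))/= exchange_big/=.
  by apply: eq_bigr => b _; rewrite -mulr_suml sumpb.
have {gibbs} : natural_entropy (join_label n) <= - \sum_v p v * ln (q v).
  move: gibbs; rewrite entE (eq_bigr (fun v => p v * ln (q v) - p v * ln (pb v.2))).
    by rewrite sumrB; lra.
  by move=> v _; rewrite mulrBr.
move=> /le_trans; apply.
have mism j : \sum_(v | mismatch v j) p v <= e.
  apply: le_trans (CU j); rewrite (_ : symdiff _ _ =
      setT `&` V @^-1` [set v | mismatch v j]).
    by rewrite pr_total_cond//; under [leRHS]eq_bigr do rewrite setTI.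
  rewrite setTI; apply/seteqP; split=> x; rewrite /symdiff /mismatch /= !ffunE.
    by case=> -[] /asboolP a /asboolPn/negbTE b; rewrite ?a ?b // (asboolT a).
  by case: (asboolP (C j x)) => Cx; case: (asboolP (U (k j) x)) => Ux //= _;
    [left|right].
rewrite (eq_bigr (fun v => p v * - ln K +
    \sum_(j < n) p v * ln (if mismatch v j then t else 1 - t))); last first.
  by move=> v _; rewrite lnq mulrDr mulr_sumr.
rewrite big_split -mulr_suml sump mul1r opprD opprK lerD2l exchange_big/=.
rewrite -sumrN -[n in n%:R]card_ord -sum1_card natr_sum mulr_suml.
apply: ler_sum => j _; rewrite mul1r.
(* Each coordinate costs [- ln (1 - t)], corrected only on mismatches, whose probability is at most
   [e]. *)
have -> : \sum_v p v * ln (if mismatch v j then t else 1 - t) =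
    \sum_(v | mismatch v j) p v * (ln t - ln (1 - t)) + ln (1 - t).
  rewrite -{2}[ln (1 - t)]mul1r -sump mulr_suml [X in _ = X + _]big_mkcond.
  rewrite -big_split; apply: eq_bigr => v _ /=.
  by case: ifP => _; rewrite ?add0r// mulrBr subrK.
rewrite -mulr_suml opprD addrC lerD2l.
have l1 : ln (1 - t) <= 0 by rewrite ln_le0//; lra.
have s0 : 0 <= \sum_(v | mismatch v j) p v.
  by apply: sumr_ge0 => ? _; exact: pr_ge0.
by have := mism j; nra.
Qed.

End entropy.

(** * Zero entropy is equivalent to total boundedness for nonempty families *)

Section family_entropy.
Context {R : realType} {d : measure_display} {X : measurableType d}.
Variables (mu : probability X R) (F : set (set X)).
Hypothesis mF : forall C, F C -> measurable C.
Local Notation pr := (pr mu).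

Let ln2_gt0 : 0 < ln 2 :> R.
Proof. by apply: ln_gt0; lra. Qed.

Lemma sequence_entropy_ge0 (C : nat -> set X) : (forall i, measurable (C i)) ->
  (0 <= sequence_entropy mu C)%E.
Proof.
move=> mC; apply: (@limn_einf_ge _ _ _ 0) => n _.
rewrite lee_fin mulr_ge0 ?invr_ge0// partition_entropyE//.
rewrite divr_ge0 ?(ltW ln2_gt0)// natural_entropy_ge0//.
exact: measurable_join_label.
Qed.

Lemma sequence_entropy_totally_bounded (C : nat -> set X) :
  totally_bounded mu F -> (forall i, F (C i)) -> (sequence_entropy mu C <= 0)%E.
Proof.
move=> tbF FC; have mC i : measurable (C i) by exact: mF.
apply/lee_addgt0Pr => r r0; rewrite add0e.
(* The budget [r * ln 2] per set is split in three: [t] makes [- ln (1 - t)] equal to [h], the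
   radius of the net keeps the mismatch term below [h], and [N] makes the constant at most
   [n * h]. *)
pose h := r * ln 2 / 3; have h0 : 0 < h by rewrite !mulr_gt0.
pose t := 1 - expR (- h).
have t01 : 0 < t < 1.
  by rewrite /t subr_gt0 expR_lt1 oppr_lt0 h0 gtrBl expR_gt0.
have lt1 : ln (1 - t) = - h by rewrite /t subKr expRK.
have lnt0 : ln t <= 0 by rewrite ln_le0// ltW//; case/andP: t01.
have [I [U [mU hU]]] := tbF (h / (1 - ln t)) ltac:(by rewrite divr_gt0//; lra).
have /choice[k hk] : forall i, exists c, pr (symdiff (C i) (U c)) <= h / (1 - ln t).
  by move=> i; exact: hU.
have [N hN] := archimedean_bound (ln (#|{ffun I -> bool}|%:R)) h0.
apply: (@limn_einf_le _ _ _ N.+1) => n Nn.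
have n0 : (0 : R) < n%:R by rewrite ltr0n; exact: leq_trans Nn.
rewrite lee_fin partition_entropyE// mulrC ler_pdivrMr// ler_pdivrMr//.
apply: (le_trans (natural_entropy_net mC mU hk t01 n)); rewrite lt1 opprK.
have e1 : h / (1 - ln t) * - ln t <= h.
  rewrite mulrAC ler_pdivrMr; last lra.
  by rewrite ler_pM2l//; lra.
have nN : N%:R * h <= n%:R * h.
  by rewrite ler_pM2r// ler_nat; exact: ltnW.
have : n%:R * (h - h / (1 - ln t) * ln t) <= n%:R * (2 * h).
  by rewrite ler_pM2l//; move: e1; rewrite mulrN; lra.
by rewrite /h in nN hN *; lra.
Qed.

Lemma family_entropy_totally_bounded :
  totally_bounded mu F -> F !=set0 -> family_entropy mu F = 0%E.
Proof.
move=> tbF [C FC]; apply/eqP; rewrite eq_le; apply/andP; split.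
  apply: ge_ereal_sup => _ [D FD <-].
  exact: sequence_entropy_totally_bounded.
apply: (@le_trans _ _ (sequence_entropy mu (fun=> C))).
  by apply: sequence_entropy_ge0 => _; exact: mF.
by apply: ereal_sup_ubound; exists (fun=> C).
Qed.

Lemma totally_bounded_family_entropy :
  family_entropy mu F = 0%E -> totally_bounded mu F.
Proof.
move=> F0; apply: contrapT => ntb.
have [C0 FC0] := not_totally_bounded_nonempty ntb.
have [e e0 hF] := not_totally_bounded mF ntb.
(* [G] picks a member of [F] far from all unions of cells of the given join; [C0] is the default
   when the given sets are not all measurable. *)
have /choice[G hG] : forall p : (nat -> set X) * nat, exists g, F g /\
    ((forall i, measurable (p.1 i)) ->
     e <= \sum_b Num.min (pr (join_label p.1 p.2 @^-1` [set b] `&` g))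
                         (pr (join_label p.1 p.2 @^-1` [set b] `\` g))).
  move=> [D n] /=; have [mD|nD] := pselect (forall i, measurable (D i)).
    have [C FC hC] := hF _ (join_label D n) (fun b => measurable_join_label mD b).
    by exists C.
  by exists C0.
(* Each choice depends on all earlier ones, so the recursion builds the list of the first [n]
   choices; reads past its end return the measurable default [set0]. *)
pose pre := fix pre n := if n is m.+1 then
  rcons (pre m) (G (nth set0 (pre m), m)) else [::].
have size_pre n : size (pre n) = n by elim: n => //= n IH; rewrite size_rcons IH.
pose C n := G (nth set0 (pre n), n).
have nth_pre n i : (i < n)%N -> nth set0 (pre n) i = C i.
  elim: n => // n IH; rewrite ltnS leq_eqVlt /= nth_rcons size_pre => /predU1P[->|iN].
    by rewrite ltnn eqxx.
  by rewrite iN IH.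
have mC i : measurable (C i) by apply: mF; exact: (hG _).1.
have mpre n i : measurable (nth set0 (pre n) i).
  have [iN|nI] := ltnP i n; first by rewrite nth_pre.
  by rewrite nth_default ?size_pre.
have labelE n : join_label (nth set0 (pre n)) n = join_label C n.
  by apply/funext => x; apply/ffunP => i; rewrite !ffunE nth_pre.
have hC n : n%:R * e <= natural_entropy mu (join_label C n).
  elim: n => [|n IH].
    by rewrite mul0r; apply: natural_entropy_ge0; exact: measurable_join_label.
  apply: le_trans (natural_entropy_succ mu mC n).
  rewrite -[n.+1%:R]natr1 mulrDl mul1r lerD//.
  by have := (hG (nth set0 (pre n), n)).2 (mpre n); rewrite /= labelE.
suff : ((e / ln 2)%:E <= family_entropy mu F)%E.
  by rewrite F0 lee_fin leNgt divr_gt0.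
apply: (@le_trans _ _ (sequence_entropy mu C)); last first.
  by apply: ereal_sup_ubound; exists C => // i; exact: (hG _).1.
(* Index 0 is left out because the normalised entropy is 0 there. *)
apply: (@limn_einf_ge _ _ _ 1) => n n1.
have n0 : (0 : R) < n%:R by rewrite ltr0n.
rewrite lee_fin partition_entropyE// mulrA ler_pM2r ?invr_gt0//.
by rewrite mulrC ler_pdivlMr// mulrC.
Qed.

End family_entropy.

(** * Coordinates and convergence in law on Lebesgue spaces *)

Section coordinate.
Context {R : realType} {d : measure_display} {X : measurableType d}.
Variable mu : probability X R.
Local Notation pr := (pr mu).

(* The last clause is how the isomorphism with [0, 1) is used: every tau with
   the law of phi is, up to null sets, phi \o T for some measurable T. *)
Definition lebesgue_coordinate (phi : X -> R) : Prop :=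
  [/\ measurable_fun [set: X] phi, forall x, 0 <= phi x < 1,
      forall a b, a <= b -> pr [set x | a <= phi x < b] <= b - a &
      forall tau : X -> R, measurable_fun [set: X] tau ->
        (forall B : set R, measurable B -> pr (tau @^-1` B) = pr (phi @^-1` B)) ->
        exists2 T : X -> X, measurable_fun [set: X] T &
          forall A, measurable A -> exists2 B : set R, measurable B &
            pr (symdiff A (phi @^-1` B)) = 0 /\
            pr (symdiff (T @^-1` A) (tau @^-1` B)) = 0].

Lemma measurable_cst_set (P : Prop) : measurable [set _ : X | P].
Proof.
have [p|np] := pselect P.
  by rewrite (_ : [set _ | _] = setT)//; apply/seteqP; split.
by rewrite (_ : [set _ | _] = set0)//; apply/seteqP; split.
Qed.

Lemma pr_null_sub A B : measurable A -> measurable B -> A `<=` B -> pr B = 0 ->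
  pr A = 0.
Proof.
by move=> mA mB AB B0; apply/eqP; rewrite eq_le pr_ge0 andbT -B0 pr_le.
Qed.

Lemma pr_null_setU A B : measurable A -> measurable B -> pr A = 0 -> pr B = 0 ->
  pr (A `|` B) = 0.
Proof.
move=> mA mB A0 B0; apply/eqP; rewrite eq_le pr_ge0 andbT.
by apply: (le_trans (prU_le mu mA mB)); rewrite A0 B0 addr0.
Qed.

Lemma measurable_pull (f : X -> R) (B : set R) :
  measurable_fun [set: X] f -> measurable B -> measurable (f @^-1` B).
Proof. by move=> mf mB; rewrite -[X in measurable X]setTI; exact: mf. Qed.

(* mY is either the Borel or the Lebesgue sigma-algebra; only the latter is
   complete, and only there do mY-sets differ from Borel sets. *)
Lemma isomorphic_coordinate (mY : set (set R)) (nu : set R -> \bar R)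
    (X0 : set X) (Y0 : set R) (f : X -> R) :
  (forall B : set R, measurable B -> mY B) ->
  (forall E E', mY E -> mY E' -> E `<=` E' -> (nu E <= nu E')%E) ->
  (forall a b, a <= b -> nu `[a, b[%classic = (b - a)%:E) ->
  (forall E, mY E -> exists (B N : set R),
     [/\ measurable B, measurable N, nu N = 0%E, B `<=` E /\ E `<=` B `|` N &
         E `<=` B \/ forall E' M, mY E' -> nu E' = 0%E -> M `<=` E' -> mY M]) ->
  measurable X0 -> mu (~` X0) = 0%E -> mY Y0 -> Y0 `<=` [set x | 0 <= x < 1] ->
  set_bij X0 Y0 f ->
  (forall E, mY E -> measurable (X0 `&` f @^-1` E)) ->
  (forall A : set X, measurable A -> A `<=` X0 ->
     mY (f @` A) /\ nu (f @` A) = mu A) ->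
  exists phi, lebesgue_coordinate phi.
Proof.
move=> borelY nu_le nu_itv approx mX0 X0null mY0 Y01 [f_fun f_inj f_surj] mf imf.
have pX0 : pr (~` X0) = 0 by rewrite /pr X0null.
have mCX0 := measurableC mX0.
pose phi x := if pselect (X0 x) then f x else 0.
have phiE x : X0 x -> phi x = f x by rewrite /phi; case: pselect.
have mphi : measurable_fun [set: X] phi.
  move=> _ B mB; rewrite setTI.
  rewrite (_ : _ @^-1` _ = (X0 `&` f @^-1` B) `|`
      (~` X0 `&` [set _ | B 0])).
    apply: measurableU; first exact/mf/borelY.
    by apply: measurableI => //; exact: measurable_cst_set.
  apply/seteqP; split=> x /=; rewrite /phi; case: pselect => X0x.
  - by left.
  - by right.
  - by case=> [[]//|[]//].
  - by case=> [[]//|[_]].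
have nu_null N : measurable N -> nu N = 0%E -> pr (phi @^-1` N) = 0.
  move=> mN N0; have mXN : measurable (X0 `&` f @^-1` N) by exact/mf/borelY.
  apply: (@pr_null_sub _ (~` X0 `|` (X0 `&` f @^-1` N))).
  - exact: (measurable_pull mphi).
  - exact: measurableU.
  - move=> x /=; rewrite /phi; case: pselect => X0x Nx; last by left.
    by right.
  - apply: pr_null_setU => //; apply/eqP; rewrite eq_le pr_ge0 andbT.
    rewrite -lee_fin -prE//; have [mI <-] := imf _ mXN (@subIsetl _ _ _).
    apply: (@le_trans _ _ (nu N)); last by rewrite N0.
    apply: nu_le => //; first exact: borelY.
    by move=> _ [x [_ Nfx] <-].
exists phi; split=> //.
- move=> x; have [X0x|nX0x] := pselect (X0 x).
    by rewrite phiE//; exact/Y01/f_fun.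
  have -> : phi x = 0 by rewrite /phi; case: pselect.
  by rewrite lexx ltr01.
- move=> a b ab; have mab : measurable (`[a, b[%classic : set R) by [].
  have mXab : measurable (X0 `&` f @^-1` `[a, b[%classic) by exact/mf/borelY.
  have mphiab := measurable_pull mphi mab.
  apply: (@le_trans _ _ (pr (~` X0) + pr (X0 `&` f @^-1` `[a, b[%classic))).
    apply: pr_le2 => //.
    move=> x; have [X0x|nX0x _] := pselect (X0 x); last by left.
    by rewrite /= phiE// => h; right.
  rewrite pX0 add0r -lee_fin -prE//; have [mI <-] := imf _ mXab (@subIsetl _ _ _).
  rewrite -nu_itv//; apply: nu_le => //; first exact: borelY.
  by move=> _ [x [_ Nfx] <-].
move=> tau mtau law.
have [x0 X0x0] : X0 !=set0.
  apply/set0P/negP => /eqP X0e; move: pX0; rewrite X0e setC0 prT => /eqP.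
  by rewrite oner_eq0.
(* [tau] is only known to pull back Borel sets. For a general [E], the part of its preimage outside
   that of [B] is sent by [f] into a null set, so completeness makes the image an [mY]-set and [f]
   pulls it back to a measurable set. *)
have mtauE E : mY E -> measurable (X0 `&` tau @^-1` E).
  move=> mE; have [B [N [mB mN N0 [BE EBN] cmpl]]] := approx E mE.
  case: cmpl => [EB|cmpl].
    rewrite (_ : E = B); last by apply/seteqP; split.
    by apply: measurableI => //; exact: (measurable_pull mtau).
  have mXN : measurable (X0 `&` tau @^-1` N).
    by apply: measurableI => //; exact: (measurable_pull mtau).
  have XN0 : pr (X0 `&` tau @^-1` N) = 0.
    apply: (pr_null_sub mXN (measurable_pull mtau mN) (@subIsetr _ _ _)).
    by rewrite law// nu_null.
  have mM : measurable (X0 `&` tau @^-1` (E `\` B)).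
    have [mI I0] := imf _ mXN (@subIsetl _ _ _).
    have sub : X0 `&` tau @^-1` (E `\` B) `<=` X0 `&` tau @^-1` N.
      by move=> x /= [X0x [Ex nBx]]; split=> //; case: (EBN _ Ex).
    have mfM : mY (f @` (X0 `&` tau @^-1` (E `\` B))).
      apply: (cmpl _ _ mI); first by rewrite I0 prE// XN0.
      exact: image_subset.
    rewrite (_ : X0 `&` tau @^-1` (E `\` B) =
        X0 `&` f @^-1` (f @` (X0 `&` tau @^-1` (E `\` B)))); first exact: mf.
    apply/seteqP; split=> x; first by move=> h; split; [case: h|exists x].
    move=> [X0x [y [X0y Ey]]] fxy; rewrite -(f_inj y x)//; exact: mem_set.
  rewrite (_ : _ `&` _ = (X0 `&` tau @^-1` B) `|` (X0 `&` tau @^-1` (E `\` B))).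
    apply: measurableU => //; apply: measurableI => //.
    exact: (measurable_pull mtau).
  apply/seteqP; split=> x /=.
    move=> [X0x Ex]; have [Bx|nBx] := pselect (B (tau x)); first by left.
    by right.
  by case=> [[X0x /BE]|[X0x []]].
have /choice[g hg] : forall y, exists x, Y0 y -> X0 x /\ f x = y.
  move=> y; have [Y0y|nY0y] := pselect (Y0 y); last by exists x0.
  by have [x X0x <-] := f_surj _ Y0y; exists x.
pose good := X0 `&` tau @^-1` Y0.
have mgood : measurable good by exact: mtauE.
(* [T] is the inverse of [f] applied to [tau]; the constant [x0] is used only on the complement of
   [good], which is null because [tau] has the law of [phi]. *)
pose T x := if pselect (good x) then g (tau x) else x0.
have TA A : T @^-1` A = (X0 `&` tau @^-1` (f @` (A `&` X0))) `|`
    (~` good `&` [set _ | A x0]).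
  apply/seteqP; split=> x /=; rewrite /T; case: pselect => gx.
  - have [X0g fg] := hg _ gx.2; move=> Ag; left; split; first exact: gx.1.
    by exists (g (tau x)).
  - by move=> Ax0; right.
  - case=> [[X0x [a [Aa X0a] fa]]|[]//]; have [X0g fg] := hg _ gx.2.
    by rewrite -(f_inj a (g (tau x))) ?fa//; exact: mem_set.
  - case=> [[X0x [a [Aa X0a] fa]]|[_]//].
    by exfalso; apply: gx; split=> //=; rewrite -fa; exact: f_fun.
have mim A : measurable A -> mY (f @` (A `&` X0)).
  by move=> mA; apply: (imf _ _ _).1; [exact: measurableI|exact: subIsetr].
exists T.
  move=> _ A mA; rewrite setTI TA; apply: measurableU; first exact/mtauE/mim.
  by apply: measurableI; [exact: measurableC|exact: measurable_cst_set].
move=> A mA; have [B [N [mB mN N0 [BE EBN] _]]] := approx _ (mim _ mA).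
have [B0 [N' [mB0 mN' N'0 [B0Y YBN] _]]] := approx _ mY0.
have mphiB := measurable_pull mphi mB; have mtauB := measurable_pull mtau mB.
have mphiN := measurable_pull mphi mN; have mtauN := measurable_pull mtau mN.
have mTA : measurable (T @^-1` A).
  rewrite TA; apply: measurableU; first exact/mtauE/mim.
  by apply: measurableI; [exact: measurableC|exact: measurable_cst_set].
have mtauB0 := measurableC (measurable_pull mtau mB0).
have mphiB0 := measurable_pull mphi mB0.
have tauB0 : pr (~` (tau @^-1` B0)) = 0.
  rewrite prC; last exact: (measurable_pull mtau).
  rewrite law// -prC//.
  apply: (@pr_null_sub _ (~` X0 `|` phi @^-1` N')).
  - exact: measurableC.
  - by apply: measurableU => //; exact: (measurable_pull mphi).
  - move=> x /= nB0; have [X0x|] := pselect (X0 x); last by left.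
    by right; have := YBN _ (f_fun _ X0x); rewrite -phiE// => -[].
  - apply: pr_null_setU => //; [exact: (measurable_pull mphi)|exact: nu_null].
exists B => //; split.
  apply: (@pr_null_sub _ (~` X0 `|` phi @^-1` N)).
  - exact: measurable_symdiff.
  - exact: measurableU.
  - move=> x; have [X0x|nX0] := pselect (X0 x); last by left.
    case=> -[/=]; rewrite phiE//.
      move=> Ax nBx; right.
      by case: (EBN (f x)) => //; exists x.
    move=> /BE[a [Aa X0a] fa] nA; exfalso; apply: nA.
    by rewrite -(f_inj a x)//; exact: mem_set.
  - by apply: pr_null_setU => //; exact: nu_null.
apply: (@pr_null_sub _ (~` X0 `|` tau @^-1` N `|` ~` (tau @^-1` B0))).
- exact: measurable_symdiff.
- by apply: measurableU => //; exact: measurableU.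
- move=> x; have [X0x|nX0] := pselect (X0 x); last by left; left.
  have [Bx|nBx] := pselect (B0 (tau x)); last by right.
  have gx : good x by split=> //; exact: B0Y.
  rewrite TA => -[[/= [[_ fA]|[/(_ gx)]//] nB]|[/= /BE fA nTA]].
    by left; right; case: (EBN _ fA).
  by exfalso; apply: nTA; left.
- apply: pr_null_setU => //; first exact: measurableU.
  by apply: pr_null_setU => //; rewrite law// nu_null.
Qed.

(** Borel sets approximate themselves; Lebesgue sets are Borel up to a Borel null set by the
    description of the completion, which is moreover complete. *)
Lemma exists_lebesgue_coordinate : lebesgue_probability_space mu ->
  exists phi, lebesgue_coordinate phi.
Proof.
case=> -[X0 [Y0 [f [[mX0 X00] [mY0 Y01 _] bij mf imf]]]].
- apply: (@isomorphic_coordinate (@measurable _ (measurableTypeR R))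
    (@lebesgue_measure R) X0 Y0 f) => //.
  + by move=> E E' mE mE' EE'; apply: le_measure => //; rewrite inE.
  + move=> a b ab; rewrite lebesgue_measure_itv/= lte_fin.
    by case: ltgtP ab => // ->; rewrite subrr.
  + by move=> E mE; exists E, set0; split; [|exact: measurable0|exact: measure0
      |split=> // x Ex; left|left].
  + by move=> E mE; exact: mf.
- apply: (@isomorphic_coordinate _
    (@completed_lebesgue_measure R) X0 Y0 f _ _ _ _ mX0 X00 mY0 Y01 bij) => //.
  + move=> B mB; exact: sub_caratheodory.
  + by move=> E E' mE mE' EE'; apply: le_measure => //; rewrite inE.
  + move=> a b ab; transitivity (@lebesgue_measure R `[a, b[%classic) => //.
    by rewrite lebesgue_measure_itv/= lte_fin; case: ltgtP ab => // ->; rewrite subrr.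
  + move=> E mE; have : completed_algebra_gen (@lebesgue_measure R) E.
      by rewrite -g_sigma_completed_algebra_genE completed_caratheodory_measurable.
    move=> [B mB [M [N [mN N0 MN]]] <-]; exists B, N; split=> //.
      by split; [exact: subsetUl|exact: setUS].
    right => E' M' mE' E'0 M'E'; apply: completed_lebesgue_measure_is_complete.
    by exists E'.
  + by move=> E mE; exact: mf.
Qed.

End coordinate.

Section convergence_in_law.
Context {R : realType} {d : measure_display} {X : measurableType d}.
Variable mu : probability X R.
Local Notation pr := (pr mu).

(** One [e] bounds both distance and probability, which is equivalent to the usual two-parameter
    form. *)
Definition cvg_in_probability (s : nat -> X -> R) (t : X -> R) : Prop :=
  forall e, 0 < e -> exists M, forall m, (M <= m)%N ->
    pr [set x | e < `|s m x - t x|] <= e.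

Lemma measurable_close (s t : X -> R) e : measurable_fun [set: X] s ->
  measurable_fun [set: X] t -> measurable [set x | e < `|s x - t x|].
Proof.
move=> ms mt; apply: (@measurable_gt _ _ _ (fun x => `|s x - t x|)).
by apply: measurableT_comp => //; exact: measurable_funB.
Qed.

(** Up to small sets [t <= c] implies [s m <= c + e], and [s' m <= c + e] implies [t' <= c + 2 * e];
    continuity from above then brings the threshold back to [c]. Two coefficients allow the
    inequality to be used in both directions. *)
Lemma law_limit_le (A A' : set X) (s s' : nat -> X -> R) (t t' : X -> R) (a b : R) :
  measurable A -> measurable A' ->
  (forall m, measurable_fun [set: X] (s m)) -> measurable_fun [set: X] t ->
  (forall m, measurable_fun [set: X] (s' m)) -> measurable_fun [set: X] t' ->
  cvg_in_probability s t -> cvg_in_probability s' t' -> 0 <= a -> 0 <= b ->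
  (exists K, forall m, (K <= m)%N -> forall c,
    a * pr (A `&` [set x | s m x <= c]) <= b * pr (A' `&` [set x | s' m x <= c])) ->
  forall c, a * pr (A `&` [set x | t x <= c]) <= b * pr (A' `&` [set x | t' x <= c]).
Proof.
move=> mA mA' ms mt ms' mt' st st' a0 b0 [K hK] c.
pose D n := A' `&` [set x | t' x <= c + 2 * n.+1%:R^-1].
have mle (f : X -> R) r : measurable_fun [set: X] f -> measurable [set x | f x <= r].
  exact: measurable_le.
have mD n : measurable (D n) by apply: measurableI => //; exact: mle.
have dD i j : (i <= j)%N -> D j `<=` D i.
  move=> ij x [A'x /= h]; split=> //=; apply: (le_trans h).
  by rewrite lerD2l ler_pM2l// lef_pV2 ?posrE// ler_nat.
have capD : \bigcap_n D n = A' `&` [set x | t' x <= c].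
  apply/seteqP; split=> x.
    move=> Dx; split; first by have [] := Dx 0%N Logic.I.
    apply/ler_addgt0Pr => e e0.
    have [n hn] := archimedean_bound 2 e0.
    have [_ /= h] := Dx n Logic.I; apply: (le_trans h); rewrite lerD2l.
    rewrite ler_pdivrMr//; apply: (le_trans hn).
    by rewrite mulrC ler_pM2l// ler_nat.
  move=> [A'x /= h] n _; split=> //=; apply: (le_trans h).
  by rewrite lerDl mulr_ge0.
apply/ler_addgt0Pr => r r0.
(* The errors add up to [a * e + b * e + b * r'] with [e <= r']. *)
pose r' := r / (a + 2 * b + 1).
have s0 : 0 < a + 2 * b + 1 by lra.
have r'0 : 0 < r' by rewrite divr_gt0.
have [n Dn] := pr_bigcap_cvg mu mD dD r'0; rewrite capD in Dn.
have [e [e0 en er]] : exists e, [/\ 0 < e, e <= n.+1%:R^-1 & e <= r'].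
  exists (Num.min n.+1%:R^-1 r'); rewrite lt_min invr_gt0 ltr0n r'0.
  by split; rewrite // ge_min lexx ?orbT.
have [M hM] := st e e0; have [M' hM'] := st' e e0.
pose m := maxn K (maxn M M').
have Km : (K <= m)%N by rewrite leq_maxl.
have {}hM := hM m ltac:(by rewrite /m !leq_max leqnn !orbT).
have {}hM' := hM' m ltac:(by rewrite /m !leq_max leqnn !orbT).
have h1 : pr (A `&` [set x | t x <= c]) <= pr (A `&` [set x | s m x <= c + e]) + e.
  apply: (@le_trans _ _ (pr (A `&` [set x | s m x <= c + e]) +
      pr [set x | e < `|s m x - t x|])); last by rewrite lerD2l.
  apply: pr_le2; [exact/measurableI/mle|exact/measurableI/mle
    |exact: measurable_close|].
  move=> x [Ax /= tc]; have [h|h] := ltP e `|s m x - t x|; first by right.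
  by left; split=> //=; move: h; rewrite ler_norml => /andP[_]; lra.
have h2 : pr (A' `&` [set x | s' m x <= c + e]) <= pr (D n) + e.
  apply: (@le_trans _ _ (pr (D n) +
      pr [set x | e < `|s' m x - t' x|])); last by rewrite lerD2l.
  apply: pr_le2 => //; [exact/measurableI/mle|exact: measurable_close|].
  move=> x [Ax /= tc]; have [h|h] := ltP e `|s' m x - t' x|; first by right.
  left; split=> //; suff : t' x <= c + 2 * n.+1%:R^-1 by [].
  move: (n.+1%:R^-1) en h => q eq; rewrite ler_norml => /andP[]; lra.
have := hK m Km (c + e).
have k1 := ler_wpM2l a0 h1; have k2 := ler_wpM2l b0 h2.
have k3 := ler_wpM2l b0 Dn; have k4 := ler_wpM2l a0 er; have k5 := ler_wpM2l b0 er.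
have k6 : (a + 2 * b + 1) * r' = r by rewrite mulrC divfK// gt_eqF.
by move: k1 k2 k3 k6; rewrite !mulrDr !mulrDl; lra.
Qed.

(** The two inequalities give equality on rays, and Dynkin's theorem extends it to Borel sets;
    complements use the equality of total masses [pr A = b * pr A']. *)
Lemma law_limit (A A' : set X) (s s' : nat -> X -> R) (t t' : X -> R) (b : R) :
  measurable A -> measurable A' ->
  (forall m, measurable_fun [set: X] (s m)) -> measurable_fun [set: X] t ->
  (forall m, measurable_fun [set: X] (s' m)) -> measurable_fun [set: X] t' ->
  cvg_in_probability s t -> cvg_in_probability s' t' -> 0 <= b ->
  pr A = b * pr A' ->
  (exists K, forall m, (K <= m)%N -> forall c,
    pr (A `&` [set x | s m x <= c]) = b * pr (A' `&` [set x | s' m x <= c])) ->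
  forall B : set R, measurable B -> pr (A `&` t @^-1` B) = b * pr (A' `&` t' @^-1` B).
Proof.
move=> mA mA' ms mt ms' mt' st st' b0 AA' [K hK] B mB.
have ray c : pr (A `&` [set x | t x <= c]) = b * pr (A' `&` [set x | t' x <= c]).
  apply/eqP; rewrite eq_le; apply/andP; split.
    rewrite -[X in X <= _]mul1r.
    apply: (@law_limit_le A A' s s' t t' 1 b) => //.
    by exists K => m Km c'; rewrite mul1r hK.
  rewrite -[X in _ <= X]mul1r.
  apply: (@law_limit_le A' A s' s t' t b 1) => //.
  by exists K => m Km c'; rewrite mul1r hK.
have mt1 := fun S => measurable_pull mt (B := S).
have mt1' := fun S => measurable_pull mt' (B := S).
have mBG : (@RGenOInfty.G R).-sigma.-measurable B by rewrite -RGenOInfty.measurableE.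
move: B mBG {mB}; apply: (@dynkin_induction _ _ (@RGenOInfty.G R)).
- exact: RGenOInfty.measurableE.
- move=> _ _ [x ->] [y ->]; exists (Num.max x y).
  apply/seteqP; split=> z /=; rewrite !in_itv/= !andbT gt_max.
    by case=> -> ->.
  by case/andP.
- by rewrite !preimage_setT !setIT.
- move=> _ [x ->].
  have compl (A0 : set X) (f : X -> R) : measurable A0 -> measurable_fun [set: X] f ->
      pr (A0 `&` f @^-1` `]x, +oo[%classic) = pr A0 - pr (A0 `&` [set y | f y <= x]).
    move=> mA0 mf; have mfx := measurable_le x mf.
    rewrite (prID mu mA0 mfx) addrC addKr; congr pr.
    apply/seteqP; split=> y; rewrite /= in_itv/= andbT ltNge.
      by case=> A0y /negP.
    by case=> A0y /negP.
  by rewrite !compl// AA' ray mulrBr.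
- move=> S mS IH.
  have compl (A0 : set X) (f : X -> R) : measurable A0 -> measurable_fun [set: X] f ->
      pr (A0 `&` f @^-1` (~` S)) = pr A0 - pr (A0 `&` f @^-1` S).
    move=> mA0 mf; have mfx := measurable_pull mf mS.
    by rewrite (prID mu mA0 mfx) addrC addKr setDE preimage_setC.
  by rewrite !compl// AA' IH mulrBr.
- move=> S mS tS IH; apply: EFin_inj; rewrite EFinM.
  have union (A0 : set X) (f : X -> R) : measurable A0 -> measurable_fun [set: X] f ->
      (pr (A0 `&` f @^-1` (\bigcup_k S k)))%:E =
      (\sum_(k <oo) mu (A0 `&` f @^-1` S k))%E.
    move=> mA0 mf; have mSk k : measurable (A0 `&` f @^-1` S k).
      by apply: measurableI => //; exact: measurable_pull.
    rewrite preimage_bigcup setI_bigcupr -prE; last exact: bigcupT_measurable.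
    rewrite measure_semi_bigcup//; last exact: bigcupT_measurable.
    by move=> i j _ _ [y [[_ Si] [_ Sj]]]; apply: tS => //; exists (f y).
  rewrite !union// -nneseriesZl//; apply: eq_eseriesr => k _.
  by rewrite !prE ?IH ?EFinM//; apply: measurableI => //;
    [exact: mt1'|exact: mt1].
Qed.

End convergence_in_law.

(** * Odometers adapted to a family of sets *)

Lemma sum_nat_mul (V : nmodType) (N q : nat) (f : nat -> V) :
  \sum_(0 <= k < N * q) f k = \sum_(0 <= i < q) \sum_(0 <= j < N) f (j + N * i)%N.
Proof.
elim: q => [|q IH]; first by rewrite muln0 !big_geq.
rewrite big_nat_recr//= -IH mulnS addnC.
rewrite (@big_cat_nat _ _ _ (N * q))//= ?leq_addr//; congr (_ + _).
by rewrite -{1}(add0n (N * q)%N) big_addn addKn.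
Qed.

Lemma exists_step (R : realType) (s : nat -> R) (w : R) (q : nat) :
  s 0%N <= w < s q -> exists2 i, (i < q)%N & s i <= w < s i.+1.
Proof.
elim: q => [|q IH] /andP[s0 sq]; first by move: (le_lt_trans s0 sq); rewrite ltxx.
have [wq|qw] := ltP w (s q); last by exists q; rewrite // qw sq.
have [i iq hi] := IH ltac:(by rewrite s0 wq).
by exists i => //; exact: leqW.
Qed.

(** * Refining a labelled partition along a set *)

Section refinement.
Context {R : realType} {d : measure_display} {X : measurableType d}.
Variables (mu : probability X R) (phi : X -> R).
Hypothesis mphi : measurable_fun [set: X] phi.
Hypothesis phi01 : forall x, 0 <= phi x < 1.
Hypothesis phi_itv : forall a b, a <= b ->
  pr mu [set x | a <= phi x < b] <= b - a.
Local Notation pr := (pr mu).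

(** Labels are natural numbers rather than elements of ['I_N], so that labels of different stages
    can be compared by reduction modulo [N]. *)
Definition uniform_labelling (l : X -> nat) (N : nat) : Prop :=
  [/\ (0 < N)%N, forall j, measurable (l @^-1` [set j]), forall x, (l x < N)%N &
      forall j, (j < N)%N -> pr (l @^-1` [set j]) = N%:R^-1].

Definition oscillation_bound (l : X -> nat) (o : nat -> R) : Prop :=
  forall x y, l x = l y -> `|phi x - phi y| <= o (l x).

Lemma measurable_itv_co (f : X -> R) a b : measurable_fun [set: X] f ->
  measurable [set x | a <= f x < b].
Proof.
move=> mf; rewrite (_ : [set _ | _] = [set x | a <= f x] `&` [set x | f x < b]).
  by apply: measurableI; [exact: measurable_ge|exact: measurable_lt].
by apply/seteqP; split=> x /= => [/andP|[-> ->]].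
Qed.

Variables (l : X -> nat) (N : nat) (C : set X) (h : nat).
Hypothesis lab : uniform_labelling l N.
Hypothesis mC : measurable C.
Hypothesis h_gt0 : (0 < h)%N.

Let q := (2 * h)%N.
(* Orders each cell lexicographically: the points of C first, then by phi. *)
Let w x := phi x + (\1_(~` C) x).
Let F (j : nat) (t : R) := pr (l @^-1` [set j] `&` [set x | w x < t]).

Let q_gt0 : (0 < q)%N. Proof. by rewrite muln_gt0. Qed.

Let N_gt0 : (0 < N)%N. Proof. by case: lab. Qed.

Let wC x : C x -> w x = phi x.
Proof. by move=> Cx; rewrite /w indicE memNset ?addr0// => /(_ Cx). Qed.

Let wNC x : ~ C x -> w x = phi x + 1.
Proof. by move=> Cx; rewrite /w indicE mem_set. Qed.

Let mw : measurable_fun [set: X] w.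
Proof.
by apply: measurable_funD => //; apply: measurable_indic; exact: measurableC.
Qed.

Let w_itv x : 0 <= w x < 2.
Proof.
have /andP[p0 p1] := phi01 x; have [Cx|Cx] := pselect (C x).
  by rewrite wC// p0; lra.
by rewrite wNC//; apply/andP; split; lra.
Qed.

Let ml j : measurable (l @^-1` [set j]). Proof. by case: lab. Qed.

Let mF j t : measurable (l @^-1` [set j] `&` [set x | w x < t]).
Proof. by apply: measurableI => //; exact: measurable_lt. Qed.

Let F_diff j a b : a <= b ->
  pr (l @^-1` [set j] `&` [set x | a <= w x < b]) = F j b - F j a.
Proof.
move=> ab; have mab := measurable_itv_co a b mw.
rewrite /F (prID mu (mF j b) (measurable_lt a mw)).
rewrite (_ : _ `&` _ `&` _ = l @^-1` [set j] `&` [set x | w x < a]); last first.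
  apply/seteqP; split=> x /=; first by case=> -[].
  by case=> lx wa; split=> //; split=> //; exact: lt_le_trans ab.
rewrite addrAC subrr add0r; congr pr; apply/seteqP; split=> x /=.
  by case=> lx /andP[aw wb]; split=> //; apply/negP; rewrite -leNgt.
by case=> -[lx wb] /negP; rewrite -leNgt => aw; split=> //; apply/andP.
Qed.

(** The factor 2 comes from the two branches of [w]: on [C] it is [phi], off [C] it is [phi] shifted
    by 1. *)
Let F_lip j a b : a <= b -> 0 <= F j b - F j a <= 2 * (b - a).
Proof.
move=> ab; rewrite -F_diff// pr_ge0/=.
have ab1 : a - 1 <= b - 1 by lra.
rewrite mulr2n mulrDl mul1r.
have := phi_itv ab1; rewrite opprB addrA subrK => h1.
apply: (@le_trans _ _ (pr [set x | a <= phi x < b] +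
    pr [set x | a - 1 <= phi x < b - 1])); last first.
  by apply: lerD; [exact: phi_itv|exact: h1].
apply: pr_le2; [|exact: measurable_itv_co|exact: measurable_itv_co|].
  by apply: measurableI => //; exact: measurable_itv_co.
move=> x [_ /=]; have [Cx|Cx] := pselect (C x); first by rewrite wC//; left.
by rewrite wNC// => /andP[? ?]; right => /=; apply/andP; split; lra.
Qed.

Let F_mono j a b : a <= b -> F j a <= F j b.
Proof. by move=> /(F_lip j)/andP[]; rewrite subr_ge0. Qed.

Let F_continuous j : continuous (F j).
Proof.
move=> t; apply/cvgrPdist_le => e e0; near=> u.
have tu : `|t - u| <= e / 2.
  by near: u; apply: cvgr_dist_le => //; rewrite divr_gt0.
have [ut|/ltW tu'] := leP u t.
  have /andP[h0 h1] := F_lip j ut.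
  by rewrite ger0_norm//; rewrite ger0_norm ?subr_ge0// in tu; lra.
have /andP[h0 h1] := F_lip j tu'.
by rewrite distrC ger0_norm//; rewrite distrC ger0_norm ?subr_ge0// in tu; lra.
Unshelve. all: by end_near. Qed.

Let F0 j : F j 0 = 0.
Proof.
rewrite /F (_ : _ `&` _ = set0) ?pr0//; apply/seteqP; split=> x //= -[_].
by have /andP[w0 _] := w_itv x; rewrite ltNge w0.
Qed.

Let F2 j : (j < N)%N -> F j 2 = N%:R^-1.
Proof.
move=> jN; have [_ _ _ /(_ j jN) <-] := lab; rewrite /F; congr pr.
by apply/seteqP; split=> x /= => [[]//|lx]; split=> //; case/andP: (w_itv x).
Qed.

(** Quantiles of [w] on a cell, by the intermediate value theorem. They need not be unique, so the
    extreme ones are fixed at 0 and 2 to enclose all values of [w]. *)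
Let threshold_ex (p : nat * nat) : exists t : R, (p.1 < N)%N -> (p.2 <= q)%N ->
  [/\ F p.1 t = p.2%:R / (N * q)%:R, p.2 = 0%N -> t = 0 & p.2 = q -> t = 2].
Proof.
case: p => j i /=; have [jN|_] := ltnP j N; last by exists 0.
have [iq|_] := leqP i q; last by exists 0.
have Nq0 : (0 : R) < (N * q)%:R by rewrite ltr0n muln_gt0 N_gt0.
have [->|i0] := eqVneq i 0%N.
  by exists 0 => _ _; rewrite F0 mul0r; split=> // q0; move: q_gt0; rewrite -q0.
have [->|iNq] := eqVneq i q.
  exists 2 => _ _; split=> // [|q0]; last by move: q_gt0; rewrite q0.
  by rewrite F2// natrM invfM mulrCA mulfV ?mulr1// pnatr_eq0 -lt0n.
have [t _ Ft] : exists2 t, t \in `[0, 2] & F j t = i%:R / (N * q)%:R.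
  apply: IVT => //; first exact: continuous_subspaceT.
  rewrite F0 F2// min_l ?max_r ?invr_ge0// divr_ge0//=.
  by rewrite ler_pdivrMr// natrM mulKf ?ler_nat// pnatr_eq0 -lt0n.
by exists t => _ _; split=> // e; [rewrite e eqxx in i0|rewrite e eqxx in iNq].
Qed.

(** Each cell is cut at the quantiles of [w]. The first [h] of its [2 * h] pieces form half of the
    cell and are nested with [C], since [w] takes points of [C] first; the ordering by [phi] bounds
    the oscillations. *)
Lemma refine_labelling : exists l' : X -> nat,
  [/\ uniform_labelling l' (N * q), forall x, (l' x %% N)%N = l x,
      exists2 o, oscillation_bound l' o &
        \sum_(0 <= j < N * q) o j <= 3 * N%:R &
      forall j, (j < N)%N ->
        pr (l @^-1` [set j] `&` [set x | (l' x < N * h)%N]) = (2 * N%:R)^-1 /\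
        ((forall x, l x = j -> (l' x < N * h)%N -> C x) \/
         (forall x, l x = j -> C x -> (l' x < N * h)%N))].
Proof.
have /choice[t0 ht0] := threshold_ex; pose t j i := t0 (j, i).
have Nq0 : (0 : R) < (N * q)%:R by rewrite ltr0n muln_gt0 N_gt0.
have Ft j i : (j < N)%N -> (i <= q)%N -> F j (t j i) = i%:R / (N * q)%:R.
  by move=> jN iq; have [] := ht0 (j, i) jN iq.
have t_0 j : (j < N)%N -> t j 0%N = 0.
  by move=> jN; have [_ + _] := ht0 (j, 0%N) jN isT; apply.
have t_q j : (j < N)%N -> t j q = 2.
  by move=> jN; have [_ _] := ht0 (j, q) jN (leqnn q); apply.
have t_mono j i i' : (j < N)%N -> (i' <= q)%N -> (i <= i')%N -> t j i <= t j i'.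
  move=> jN iq; rewrite leq_eqVlt => /predU1P[->//|ii].
  rewrite leNgt; apply/negP => /ltW /(F_mono j).
  rewrite !Ft// ?(leq_trans (ltnW ii))// ler_pM2r ?invr_gt0// ler_nat.
  by rewrite leqNgt ii.
have lN x : (l x < N)%N by case: lab.
have /choice[r hr] : forall x, exists i,
    (i < q)%N /\ t (l x) i <= w x < t (l x) i.+1.
  move=> x; have [i iq hi] := @exists_step R (t (l x)) (w x) q
    ltac:(by rewrite t_0// t_q//; exact: w_itv).
  by exists i.
have rP x i : (i < q)%N -> t (l x) i <= w x < t (l x) i.+1 -> r x = i.
  move=> iq /andP[h1 h2]; have [rq /andP[h3 h4]] := hr x.
  have [ri|ir|//] := ltngtP (r x) i.
    have := t_mono (l x) (r x).+1 i (lN x) (ltnW iq) ri.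
    by move=> /le_trans/(_ h1)/(lt_le_trans h4); rewrite ltxx.
  have := t_mono (l x) i.+1 (r x) (lN x) (ltnW rq) ir.
  by move=> /le_trans/(_ h3)/(lt_le_trans h2); rewrite ltxx.
(* The cell is the low digit and the piece number the high one, so the cyclic successor visits every
   cell before the piece number changes. *)
pose l' x := (l x + N * r x)%N.
have l'mod x : (l' x %% N)%N = l x by rewrite /l' mulnC addnC modnMDl modn_small.
have l'div x : (l' x %/ N)%N = r x.
  by rewrite /l' mulnC addnC divnMDl// divn_small// addn0.
have l'lt x : (l' x < N * q)%N.
  by rewrite mulnC -ltn_divLR// l'div; case: (hr x).
have fiber k : (k < N * q)%N -> l' @^-1` [set k] = l @^-1` [set (k %% N)%N] `&`
    [set x | t (k %% N)%N (k %/ N)%N <= w x < t (k %% N)%N (k %/ N).+1].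
  move=> kNq; have kq : (k %/ N < q)%N by rewrite ltn_divLR// mulnC.
  apply/seteqP; split=> x /=.
    by move=> <-; rewrite l'mod l'div; split=> //; case: (hr x).
  case=> lx hx; rewrite /l' (@rP x (k %/ N)%N)// lx//.
  by rewrite addnC mulnC -divn_eq.
(* The jump of G at 1 pays for the one piece that meets both C and ~` C. *)
pose G (a : R) : R := a + (if 1 < a then 1 else 0).
exists l'; split=> //.
- split=> //; first by rewrite muln_gt0 N_gt0.
    move=> k; have [kNq|kNq] := ltnP k (N * q).
      by rewrite fiber//; apply: measurableI => //; exact: measurable_itv_co.
    rewrite (_ : _ @^-1` _ = set0)//; apply/seteqP; split=> x //= lk.
    by move: (l'lt x); rewrite lk ltnNge kNq.
  move=> k kNq; have kN : (k %% N < N)%N by rewrite ltn_mod.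
  have kq : (k %/ N < q)%N by rewrite ltn_divLR// mulnC.
  rewrite fiber// F_diff; last exact: t_mono.
  rewrite !Ft//; last exact: ltnW.
  by rewrite -mulrBl -[_.+1%:R]natr1 addrC addKr mul1r.
- exists (fun k => G (t (k %% N)%N (k %/ N).+1) - G (t (k %% N)%N (k %/ N)%N)).
    move=> x y l'xy; rewrite l'mod l'div.
    have lxy : l y = l x by rewrite -!l'mod l'xy.
    have rxy : r y = r x by rewrite -!l'div l'xy.
    have [_ /andP[x1 x2]] := hr x; have [_ /andP[y1 y2]] := hr y.
    rewrite lxy rxy in y1 y2; move: (t _ _) (t _ _) x1 x2 y1 y2 => b a x1 x2 y1 y2.
    have /andP[px0 px1] := phi01 x; have /andP[py0 py1] := phi01 y.
    have [b1|b1] := leP b 1.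
      have Cx : C x.
        by apply: contrapT => nC; move: x2; rewrite wNC//; lra.
      have Cy : C y.
        by apply: contrapT => nC; move: y2; rewrite wNC//; lra.
      rewrite wC// in x1 x2; rewrite wC// in y1 y2.
      rewrite /G (ltNge 1 b) b1 (ltNge 1 a) (_ : a <= 1)/=; last lra.
      by rewrite !addr0 ler_norml; apply/andP; split; lra.
    have [a1|a1] := ltP 1 a.
      have Cx : ~ C x.
        by move=> Cx; move: x1; rewrite wC//; lra.
      have Cy : ~ C y.
        by move=> Cy; move: y1; rewrite wC//; lra.
      rewrite wNC// in x1 x2; rewrite wNC// in y1 y2.
      by rewrite /G b1 a1 ler_norml; apply/andP; split; lra.
    rewrite /G b1 (ltNge 1 a) a1/= addr0 ler_norml; apply/andP; split; lra.
  (* Summed over the pieces of one cell, the differences telescope to [G 2 - G 0 = 3]. *)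
  rewrite sum_nat_mul exchange_big_nat/=.
  apply: (@le_trans _ _ (\sum_(0 <= j < N) 3)); last first.
    by rewrite sumr_const_nat subn0 mulr_natr.
  apply: ler_sum_nat => j /andP[_ jN].
  rewrite (eq_bigr (fun i => G (t j i.+1) - G (t j i))); last first.
    move=> i _; rewrite mulnC addnC modnMDl modn_small// divnMDl//.
    by rewrite divn_small// addn0.
  rewrite telescope_sumr// t_q// t_0// /G.
  by rewrite ltr1n ltr10 /= add0r subr0 -(natrD _ 2 1).
- move=> j jN; have hq : (h <= q)%N by rewrite /q leq_pmull.
  have l'h x : (l' x < N * h)%N = (r x < h)%N.
    by rewrite mulnC -ltn_divLR// l'div.
  have rh x : l x = j -> (r x < h)%N = (w x < t j h).
    move=> lx; have [rq /andP[]] := hr x; rewrite lx => wr wr1.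
    have [rh|hr'] := ltnP (r x) h.
      by apply/esym/(lt_le_trans wr1); exact: t_mono.
    by apply/esym/negbTE; rewrite -leNgt (le_trans _ wr)// t_mono// ltnW.
  split.
    transitivity (F j (t j h)).
      congr pr; apply/seteqP; split=> x /= [lx]; rewrite l'h rh//.
    have hR0 : h%:R != 0 :> R by rewrite pnatr_eq0 -lt0n.
    have NR0 : N%:R != 0 :> R by rewrite pnatr_eq0 -lt0n.
    by rewrite Ft// /q !natrM; field; rewrite hR0 NR0.
  (* The value 1 separates the two branches of [w]: a median at most 1 leaves only points of [C]
     below it, a larger one leaves all of them. *)
  have [th|th] := leP (t j h) 1.
    left=> x lx; rewrite l'h rh// => wt; apply: contrapT => nC; move: wt.
    by rewrite wNC//; have /andP[p0 _] := phi01 x; lra.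
  right=> x lx Cx; rewrite l'h rh// wC//.
  by have /andP[_ p1] := phi01 x; lra.
Qed.

End refinement.

Lemma limn_sup_itv (R : realType) (u : nat -> R) m a b : has_ubound (range u) ->
  has_lbound (range u) -> (forall k, (m <= k)%N -> a <= u k <= b) ->
  a <= limn_sup u <= b.
Proof.
move=> ubu lbu hu; have cu : cvgn (sups u).
  by apply/cvg_ex; exists (inf (range (sups u))); exact: cvg_sups_inf.
apply/andP; split.
  apply: limr_ge => //; near=> n; apply: (@le_trans _ _ (u n)).
    have mn : (m <= n)%N by near: n; exists m.
    by have /andP[] := hu n mn.
  apply: ub_le_sup; first exact: has_ubound_sdrop.
  by exists n => /=.
apply: limr_le => //; near=> n; apply: ge_sup; first by exists (u n), n => /=.
move=> _ [k /= nk <-]; have mk : (m <= k)%N.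
  by apply: leq_trans nk; near: n; exists m.
by have /andP[] := hu k mk.
Unshelve. all: by end_near. Qed.

Section labels.
Context {R : realType} {d : measure_display} {X : measurableType d}.
Variable mu : probability X R.
Local Notation pr := (pr mu).

Lemma measurable_label_set (l : X -> nat) (P : set nat) :
  (forall j, measurable (l @^-1` [set j])) -> measurable (l @^-1` P).
Proof.
move=> ml; rewrite (_ : _ @^-1` _ = \bigcup_(j in P) l @^-1` [set j]).
  by apply: bigcup_measurable => j _; exact: ml.
by apply/seteqP; split=> [x Px|x [j Pj /= ->]//]; exists (l x).
Qed.

Lemma measurable_label_fun (l : X -> nat) (g : nat -> R) :
  (forall j, measurable (l @^-1` [set j])) ->
  measurable_fun [set: X] (fun x => g (l x)).
Proof.
move=> ml _ B mB; rewrite setTI.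
exact: (@measurable_label_set l (g @^-1` B)).
Qed.

Variables (l : X -> nat) (N : nat).
Hypothesis lab : uniform_labelling mu l N.

Lemma pr_label (A : set X) (P : pred nat) : measurable A ->
  pr (A `&` [set x | P (l x)]) = \sum_(j < N | P j) pr (A `&` l @^-1` [set (j : nat)]).
Proof.
have [N0 ml lN lu] := lab; move=> mA.
have mZ (j : 'I_N) : measurable ((fun x => Ordinal (lN x)) @^-1` [set j]).
  rewrite (_ : _ @^-1` _ = l @^-1` [set (j : nat)])//.
  by apply/seteqP; split=> x /= => [<-//|lx]; exact: val_inj.
have := pr_total_cond mu (fun j : 'I_N => P j) mZ mA => ->; apply: eq_bigr => j _.
congr (pr (_ `&` _)); apply/seteqP; split=> x /= => [<-//|lx]; exact: val_inj.
Qed.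

Lemma pr_label_uniform (P : pred nat) :
  pr [set x | P (l x)] = \sum_(j < N | P j) N%:R^-1.
Proof.
have [N0 ml lN lu] := lab.
rewrite -[X in pr X]setTI pr_label//; apply: eq_bigr => j _.
by rewrite setTI lu.
Qed.

(** The cyclic successor permutes cells of equal mass. *)
Lemma pr_label_shift (P : pred nat) :
  pr [set x | P ((l x).+1 %% N)%N] = pr [set x | P (l x)].
Proof.
rewrite (pr_label_uniform (fun i => P (i.+1 %% N)%N)) pr_label_uniform.
rewrite [RHS](reindex (@ordS N)); last by apply: onW_bij; exact: ordS_bij.
by apply: eq_bigl => j.
Qed.

Lemma label_nonempty j : (j < N)%N -> exists y, l y = j.
Proof.
have [N0 _ _ lu] := lab.
move=> jN; have [//|y0] := pselect (exists y, l y = j).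
have := lu _ jN; rewrite (_ : _ @^-1` _ = set0).
  by rewrite pr0 => /esym/eqP; rewrite invr_eq0 pnatr_eq0 gtn_eqF.
by apply/seteqP; split=> y //= ly; apply: y0; exists y.
Qed.

End labels.

(** * The odometer of a refining sequence of labellings *)

Section odometer.
Context {R : realType} {d : measure_display} {X : measurableType d}.
Variables (mu : probability X R) (phi : X -> R).
Hypothesis coord : lebesgue_coordinate mu phi.
Local Notation pr := (pr mu).

Variables (l : nat -> X -> nat) (N : nat -> nat) (o : nat -> nat -> R).
Hypothesis lab : forall k, uniform_labelling mu (l k) (N k).
Hypothesis N0 : N 0%N = 1%N.
Hypothesis compat : forall k x, (l k.+1 x %% N k)%N = l k x.
Hypothesis dvdN : forall k, (N k %| N k.+1)%N.
Hypothesis osc : forall k, oscillation_bound phi (l k) (o k).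
Hypothesis fine_osc : forall k, 4 ^+ k * \sum_(0 <= j < N k) o k j <= (N k)%:R.

(* y (k, j) is a sample point of the cell labelled j at stage k. *)
Variable y : nat * nat -> X.
Hypothesis yP : forall k j, (j < N k)%N -> l k (y (k, j)) = j.

Let mphi : measurable_fun [set: X] phi. Proof. by case: coord. Qed.

Let phi01 x : 0 <= phi x < 1. Proof. by case: coord. Qed.

Let N_gt0 k : (0 < N k)%N. Proof. by case: (lab k). Qed.

Let ml k j : measurable (l k @^-1` [set j]). Proof. by case: (lab k). Qed.

Let lN k x : (l k x < N k)%N. Proof. by case: (lab k). Qed.

Let lu k j : (j < N k)%N -> pr (l k @^-1` [set j]) = (N k)%:R^-1.
Proof. by case: (lab k) => _ _ _; apply. Qed.

Let dvdN_le k m : (k <= m)%N -> (N k %| N m)%N.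
Proof.
move=> /subnKC <-; elim: (m - k)%N => [|i IH]; first by rewrite addn0.
by rewrite addnS; exact: dvdn_trans (dvdN _).
Qed.

Let compat_le k m x : (k <= m)%N -> (l m x %% N k)%N = l k x.
Proof.
move=> /subnKC <-; elim: (m - k)%N => [|i IH].
  by rewrite addn0 modn_small.
rewrite addnS -[RHS]IH -(compat (k + i)) modn_dvdm//.
by apply: dvdN_le; exact: leq_addr.
Qed.

Let o_ge0 k j : (j < N k)%N -> 0 <= o k j.
Proof.
move=> /(label_nonempty (lab k))[z <-]; apply: le_trans (osc (erefl (l k z))).
by rewrite subrr normr0.
Qed.

Let rough k : set nat := [set j | 2^-1 ^+ k < o k j].

Let half_gt0 k : 0 < 2^-1 ^+ k :> R. Proof. by rewrite exprn_gt0. Qed.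

(** Markov's inequality: by [fine_osc] the average oscillation over the cells is at most 4^-k. *)
Let pr_rough k : pr (l k @^-1` rough k) <= 2^-1 ^+ k.
Proof.
rewrite (_ : _ @^-1` _ = [set x | (2^-1 ^+ k < o k (l k x))%R])//.
rewrite (pr_label_uniform (lab k) (fun j => 2^-1 ^+ k < o k j)) big_mkcond/=.
have Nk0 : (0 : R) < (N k)%:R by rewrite ltr0n.
apply: (@le_trans _ _ (\sum_(j < N k) 2 ^+ k * o k j / (N k)%:R)).
  apply: ler_sum => j _; case: ifPn => [oj|_]; last first.
    by rewrite divr_ge0// mulr_ge0 ?exprn_ge0// o_ge0.
  rewrite -[leLHS]mul1r ler_pM2r ?invr_gt0//.
  have := ltW oj; rewrite -(ler_pM2l (exprn_gt0 k (ltr0n R 2))).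
  by rewrite -exprMn mulfV// expr1n.
rewrite -mulr_suml -mulr_sumr ler_pdivrMr// exprVn.
rewrite ler_pdivlMl ?exprn_gt0// mulrA -exprMn -natrM.
by have := fine_osc k; rewrite big_mkord.
Qed.

Let s k x := phi (y (k, l k x)).

Let t k x := phi (y (k, ((l k x).+1 %% N k)%N)).

Let next_lt k x : ((l k x).+1 %% N k < N k)%N. Proof. by rewrite ltn_mod. Qed.

Let s_close k x : `|s k x - phi x| <= o k (l k x).
Proof. by rewrite distrC; apply: osc; rewrite yP. Qed.

(** Since [N k] divides [N k.+1], the successor cell at stage [k.+1] lies inside the successor cell
    at stage [k]. *)
Let t_close k x : `|t k.+1 x - t k x| <= o k ((l k x).+1 %% N k)%N.
Proof.
rewrite distrC /t; set j := ((l k x).+1 %% N k)%N.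
have jN : (j < N k)%N by exact: next_lt.
have lj : l k (y (k.+1, ((l k.+1 x).+1 %% N k.+1)%N)) = j.
  rewrite -compat yP ?next_lt// /j -(compat k x) (modn_dvdm _ (dvdN k)).
  by rewrite -(addn1 (l k.+1 x)) -(addn1 (_ %% _)%N) modnDml.
by have := @osc k (y (k, j)) (y (k.+1, ((l k.+1 x).+1 %% N k.+1)%N));
  rewrite yP// lj; apply.
Qed.

Let ms k : measurable_fun [set: X] (s k).
Proof. exact: (measurable_label_fun (fun j => phi (y (k, j))) (ml k)). Qed.

Let mt k : measurable_fun [set: X] (t k).
Proof.
exact: (measurable_label_fun (fun j => phi (y (k, (j.+1 %% N k)%N))) (ml k)).
Qed.

Let small_half (e : R) : 0 < e -> exists k, 2^-1 ^+ k <= e.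
Proof.
move=> e0; have [k hk] := archimedean_bound 1 e0; exists k.
have k2 : k%:R <= 2 ^+ k :> R by rewrite -natrX ler_nat ltnW// ltn_expl.
rewrite exprVn -[leLHS]mul1r ler_pdivrMr ?exprn_gt0//.
by apply: (le_trans hk); rewrite mulrC ler_pM2l.
Qed.

Let half_le k m : (k <= m)%N -> 2^-1 ^+ m <= 2^-1 ^+ k :> R.
Proof. by move=> km; apply: ler_wiXn2l => //; rewrite ?invr_ge0// invf_le1// ler1n. Qed.

Let cvg_s : cvg_in_probability mu s phi.
Proof.
move=> e e0; have [M hM] := small_half e0; exists M => m Mm.
have me : 2^-1 ^+ m <= e by exact: le_trans (half_le Mm) hM.
apply: (le_trans _ (le_trans (pr_rough m) me)); apply: pr_le.
- exact: measurable_close.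
- exact: measurable_label_set.
- by move=> x /= h; apply: (le_lt_trans me); apply: (lt_le_trans h); exact: s_close.
Qed.

Let bad k := [set x | rough k ((l k x).+1 %% N k)%N].

Let mbad k : measurable (bad k).
Proof. exact: (@measurable_label_set _ _ (l k) (fun j => rough k (j.+1 %% N k)%N)). Qed.

Let pr_bad k : pr (bad k) <= 2^-1 ^+ k.
Proof.
by rewrite (pr_label_shift (lab k) (fun j => 2^-1 ^+ k < o k j)); exact: pr_rough.
Qed.

(* t k x samples the cell that follows the stage-k cell of x, so that T0 x is the
   coordinate of the image of x under the odometer. *)
Let T0 : X -> R := fun x => limn_sup (fun k => t k x).

Let t_itv k x : 0 <= t k x <= 1.
Proof. by have /andP[-> /ltW ->] := phi01 (y (k, ((l k x).+1 %% N k)%N)). Qed.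

Let t_ub x : has_ubound (range (t^~ x)).
Proof. by exists 1 => _ [k _ <-]; case/andP: (t_itv k x). Qed.

Let t_lb x : has_lbound (range (t^~ x)).
Proof. by exists 0 => _ [k _ <-]; case/andP: (t_itv k x). Qed.

Let mT0 : measurable_fun [set: X] T0.
Proof.
exact: (measurable_fun_limn_sup (fun x _ => t_ub x) (fun x _ => t_lb x) mt).
Qed.

Let T0_close m x : (forall k, ~ bad (m + k) x) -> `|t m x - T0 x| <= 2 * 2^-1 ^+ m.
Proof.
move=> good.
have step i : `|t (m + i)%N x - t m x| <= 2 * (2^-1 ^+ m - 2^-1 ^+ (m + i)).
  elim: i => [|i IH]; first by rewrite addn0 !subrr normr0 mulr0.
  rewrite addnS -(subrKA (t (m + i)%N x)).
  apply: (le_trans (ler_normD _ _)); apply: (le_trans (lerD _ IH)).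
    apply: (le_trans (t_close _ _)); rewrite leNgt; apply/negP.
    exact: good.
  by rewrite exprS; lra.
have h k : (m <= k)%N ->
    t m x - 2 * 2^-1 ^+ m <= t k x <= t m x + 2 * 2^-1 ^+ m.
  move=> /subnKC <-; have := step (k - m)%N.
  have := half_gt0 (m + (k - m)); rewrite ler_norml => ? /andP[? ?].
  by apply/andP; split; lra.
have /andP[h1 h2] := limn_sup_itv (t_ub x) (t_lb x) h.
by rewrite ler_norml; apply/andP; split; rewrite /T0; lra.
Qed.

(** Off the bad sets from stage [m] on, the increments of [t] are summable; those bad sets have
    total mass at most [2 * 2^-1 ^+ m]. *)
Let cvg_t : cvg_in_probability mu t T0.
Proof.
move=> e e0; have e20 : 0 < e / 2 by rewrite divr_gt0.
have [M hM] := small_half e20; exists M => m Mm.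
have me : 2 * 2^-1 ^+ m <= e by have := le_trans (half_le Mm) hM; lra.
apply: (@le_trans _ _ (pr (\bigcup_k bad (m + k)))).
  apply: pr_le; [exact: measurable_close|exact: bigcupT_measurable|].
  move=> x /= h; apply: contrapT => nb.
  have /T0_close : forall k, ~ bad (m + k) x by move=> k bk; apply: nb; exists k.
  by rewrite leNgt (le_lt_trans me h).
apply: (le_trans _ me); apply: pr_bigcup_le => // n.
apply: (@le_trans _ _ (2 * (2^-1 ^+ m - 2^-1 ^+ (m + n)))).
  elim: n => [|n IH]; first by rewrite big_geq// addn0 subrr mulr0.
  rewrite big_nat_recr//= addnS exprS.
  by have := pr_bad (m + n); lra.
by have := half_gt0 (m + n); lra.
Qed.

(** At every stage [m >= k] the successor preserves mass and reduces to the successor modulo [N k];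
    hence [t m] on cell [j] is distributed as [s m] on the next cell, and [law_limit] passes to the
    limit. *)
Let law k j (B : set R) : (j < N k)%N -> measurable B ->
  pr (l k @^-1` [set j] `&` T0 @^-1` B) =
  pr (l k @^-1` [set (j.+1 %% N k)%N] `&` phi @^-1` B).
Proof.
move=> jN mB; rewrite -[RHS]mul1r.
apply: (law_limit (ml k j) (ml k _) mt mT0 ms mphi cvg_t cvg_s ler01) => //.
  by rewrite mul1r !lu// ltn_mod.
exists k => m km c; rewrite mul1r.
pose P i := (i %% N k == j.+1 %% N k)%N && (phi (y (m, i)) <= c).
rewrite (_ : l k @^-1` [set j] `&` _ = [set x | P ((l m x).+1 %% N m)%N]).
  rewrite (pr_label_shift (lab m)); congr pr; apply/seteqP; split=> x.
    rewrite /P /= (compat_le x km) => /andP[/eqP -> hc]; split=> //.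
  by case=> /= lx hc; rewrite /P (compat_le x km) lx eqxx.
have modE x : ((l m x).+1 %% N m %% N k == j.+1 %% N k)%N = (l k x == j).
  rewrite modn_dvdm ?dvdN_le// -(compat_le x km) -!(addn1 (l m x)) -(addn1 j).
  by rewrite eqn_modDr (modn_small jN).
apply/seteqP; split=> x; rewrite /P /= modE.
  by case=> -> hc; rewrite eqxx.
by case/andP => /eqP -> hc.
Qed.

Lemma odometer_transformation : exists T : X -> X,
  [/\ measure_preserving mu T, ergodic mu T &
      forall k j A, (j < N k)%N -> measurable A ->
        pr (l k @^-1` [set j] `&` T @^-1` A) =
        pr (l k @^-1` [set (j.+1 %% N k)%N] `&` A)].
Proof.
have l0 : l 0%N @^-1` [set 0%N] = setT.
  by apply/seteqP; split=> x //= _; have := lN 0 x; rewrite N0 ltnS leqn0 => /eqP.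
have lawT B : measurable B -> pr (T0 @^-1` B) = pr (phi @^-1` B).
  by move=> mB; have := law (N_gt0 0) mB; rewrite N0 modn1 l0 !setTI.
have [_ _ _ /(_ T0 mT0 lawT)[T mT hT]] := coord.
have mTA A : measurable A -> measurable (T @^-1` A).
  by move=> mA; rewrite -[X in measurable X]setTI; exact: mT.
have pr_symdiff (A A' D : set X) : measurable A -> measurable A' -> measurable D ->
    pr (symdiff A A') = 0 -> pr (D `&` A) = pr (D `&` A').
  move=> mA mA' mD AA'; have mS := measurable_symdiff mA mA'.
  apply/eqP; rewrite eq_le; apply/andP; split; rewrite -[leRHS]addr0 -AA';
    apply: pr_le2 => //; try exact: measurableI.
    by move=> x [Dx Ax]; have [|] := pselect (A' x); [left|right; left].
  by move=> x [Dx Ax]; have [|] := pselect (A x); [left|right; right].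
have key k j A : (j < N k)%N -> measurable A ->
    pr (l k @^-1` [set j] `&` T @^-1` A) = pr (l k @^-1` [set (j.+1 %% N k)%N] `&` A).
  move=> jN mA; have [B mB [AB TAB]] := hT A mA.
  rewrite (pr_symdiff _ _ _ (mTA _ mA) (measurable_pull mT0 mB) (ml k j) TAB).
  by rewrite law// -(pr_symdiff _ _ _ mA (measurable_pull mphi mB) (ml k _) AB).
exists T; split=> //.
  split=> // A mA; rewrite !prE//; last exact: mTA.
  by have := key 0%N 0%N A (N_gt0 0) mA; rewrite N0 modn1 l0 !setTI => ->.
move=> A mA TA.
(* An invariant set has equal mass in all cells of a stage, hence is independent of every [s m] and,
   in the limit, of [phi]. *)
have cyc k j : (j < N k)%N ->
    pr (l k @^-1` [set j] `&` A) = pr (l k @^-1` [set 0%N] `&` A).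
  elim: j => // j IH jN; rewrite -IH ?(ltnW jN)//.
  by rewrite -{2}TA key ?(ltnW jN)// modn_small.
have cell k j : (j < N k)%N -> pr (A `&` l k @^-1` [set j]) = pr A * (N k)%:R^-1.
  move=> jN; have Nk0 : (N k)%:R != 0 :> R by rewrite pnatr_eq0 -lt0n.
  have -> : pr A = \sum_(i < N k) pr (A `&` l k @^-1` [set j]).
    rewrite -[in LHS](setIT A) (_ : setT = [set x | xpredT (l k x)]); last first.
      by apply/seteqP; split.
    have := pr_label (lab k) xpredT mA => ->; apply: eq_bigr => i _.
    by rewrite ![A `&` _]setIC !cyc.
  by rewrite sumr_const card_ord -[X in X / _]mulr_natr mulfK.
have indep B : measurable B -> pr (A `&` phi @^-1` B) = pr A * pr (phi @^-1` B).
  move=> mB; rewrite -[X in _ = _ * pr X]setTI.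
  apply: (law_limit mA measurableT ms mphi ms mphi cvg_s cvg_s (pr_ge0 mu A)) => //.
    by rewrite prT mulr1.
  exists 0%N => m _ c; rewrite setTI.
  have := pr_label (lab m) (fun i => phi (y (m, i)) <= c) mA => ->.
  have := pr_label_uniform (lab m) (fun i => phi (y (m, i)) <= c) => ->.
  by rewrite mulr_sumr; apply: eq_bigr => i _; rewrite cell.
(* Up to a null set [A] is itself determined by [phi], so it is independent of itself and [pr A] is
   0 or 1. *)
have [B mB [AB _]] := hT A mA.
have mphiB := measurable_pull mphi mB.
have := indep B mB; rewrite -(pr_symdiff _ _ _ mA mphiB mA AB) setIid.
have := pr_symdiff _ _ _ mA mphiB measurableT AB; rewrite !setTI => <-.
move=> /esym/eqP; rewrite -subr_eq0 -{3}[pr A]mulr1 -mulrBr mulf_eq0 => /orP[/eqP A0|].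
  by left; rewrite prE// A0.
by rewrite subr_eq0 => /eqP A1; right; rewrite prE// A1.
Qed.

End odometer.

(** * Averages along an odometer that stay away from the mean *)

Section lower_bound.
Context {R : realType} {d : measure_display} {X : measurableType d}.
Variables (mu : probability X R) (T : X -> X).
Hypothesis Tmp : measure_preserving mu T.
Local Notation pr := (pr mu).

Variables (l l' : X -> nat) (N h : nat) (C : set X).
Hypothesis lab : uniform_labelling mu l N.
Hypothesis lab' : uniform_labelling mu l' (N * (2 * h)).
Hypothesis mC : measurable C.
Hypothesis h_gt0 : (0 < h)%N.
Let V := [set x | (l' x < N * h)%N].
Hypothesis half_level : forall j, (j < N)%N ->
  pr (l @^-1` [set j] `&` V) = (2 * N%:R)^-1 /\
  ((forall x, l x = j -> V x -> C x) \/ (forall x, l x = j -> C x -> V x)).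
Hypothesis shift : forall j A, (j < N * (2 * h))%N -> measurable A ->
  pr (l' @^-1` [set j] `&` T @^-1` A) =
  pr (l' @^-1` [set (j.+1 %% (N * (2 * h)))%N] `&` A).

Let N' := (N * (2 * h))%N.

Let N_gt0 : (0 < N)%N. Proof. by case: lab. Qed.

Let N'_gt0 : (0 < N')%N. Proof. by case: lab'. Qed.

Let ml j : measurable (l @^-1` [set j]). Proof. by case: lab. Qed.

Let ml' j : measurable (l' @^-1` [set j]). Proof. by case: lab'. Qed.

Let mV : measurable V.
Proof. exact: (@measurable_label_set _ _ l' (fun j => (j < N * h)%N)). Qed.

Let sum_cells A : measurable A -> pr A = \sum_(j < N) pr (A `&` l @^-1` [set (j : nat)]).
Proof.
move=> mA; rewrite -[in LHS](setIT A) (_ : setT = [set x | xpredT (l x)]).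
  by have := pr_label lab xpredT mA => ->.
by apply/seteqP; split.
Qed.

Let pr_V : pr V = 2^-1.
Proof.
have NR0 : N%:R != 0 :> R by rewrite pnatr_eq0 -lt0n.
rewrite sum_cells// (eq_bigr (fun=> (2 * N%:R)^-1)).
  by rewrite sumr_const card_ord -[LHS]mulr_natl; field.
by move=> j _; rewrite setIC; have [] := half_level (ltn_ord j).
Qed.

(** In each cell [V] has half of the mass. If it lies inside [C] the excess is half of the mass
    outside [C]; if it contains [C], half of the mass of [C]. *)
Let pr_CV : 2^-1 * \sum_(j < N) Num.min (pr (l @^-1` [set (j : nat)] `&` C))
                                       (pr (l @^-1` [set (j : nat)] `\` C)) <=
  pr (C `&` V) - pr C * 2^-1.
Proof.
have mCV : measurable (C `&` V) by exact: measurableI.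
rewrite (sum_cells mCV) (sum_cells mC) mulr_sumr mulr_suml -sumrB.
apply: ler_sum => j _; have [pV CV] := half_level (ltn_ord j).
have NR0 : N%:R != 0 :> R by rewrite pnatr_eq0 -lt0n.
have [_ _ _ /(_ j (ltn_ord j))] := lab; rewrite (prID mu (ml j) mC) => pl.
rewrite [C `&` l @^-1` _]setIC.
set a := pr (l @^-1` _ `&` C) in pl *; set b := pr (l @^-1` _ `\` C) in pl *.
have [ma mb] : Num.min a b <= a /\ Num.min a b <= b.
  by split; rewrite ge_min lexx ?orbT.
case: CV => sub.
  rewrite (_ : C `&` V `&` _ = l @^-1` [set (j : nat)] `&` V).
    have : (2 * N%:R)^-1 = 2^-1 * N%:R^-1 :> R by field.
    by rewrite pV => ->; rewrite -pl; lra.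
  apply/seteqP; split=> x /=; first by case=> -[].
  by case=> lx Vx; split=> //; split=> //; exact: sub lx Vx.
rewrite (_ : C `&` V `&` _ = l @^-1` [set (j : nat)] `&` C).
  by rewrite -/a; lra.
apply/seteqP; split=> x /=; first by case=> -[].
by case=> lx Cx; split=> //; split=> //; exact: sub lx Cx.
Qed.

(** [T] advances labels by one, so outside [V] only the last label, whose successor is 0, can enter
    [V]. *)
Let pr_escape : pr (T @^-1` V `\` V) <= N'%:R^-1.
Proof.
have mTV := measurable_preimage Tmp mV.
have mD : measurable (T @^-1` V `\` V) by exact: measurableD.
set D := T @^-1` V `\` V in mD *.
pose last j := (j == N'.-1)%N.
have NhN' : (N * h < N')%N.
  by rewrite /N' ltn_mul2l N_gt0/= -[X in (X < _)%N]mul1n ltn_mul2r h_gt0.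
have lastN : (N'.-1 < N')%N by rewrite prednK.
apply: (@le_trans _ _ (pr (l' @^-1` [set N'.-1]) +
    pr (D `&` [set x | ~~ last (l' x)]))).
  apply: pr_le2 => //.
    apply: measurableI => //.
    exact: (@measurable_label_set _ _ l' (fun j => ~~ last j)).
  move=> x Dx; have [lx|lx] := boolP (last (l' x)); last by right.
  by left; exact/eqP.
have [_ _ _ ->//] := lab'; rewrite gerDl.
have := pr_label lab' (fun j => ~~ last j) mD => ->.
rewrite big1// => j jl; have jN' : (j.+1 < N')%N.
  by rewrite ltn_neqAle ltn_ord andbT -[X in _ != X](prednK N'_gt0) eqSS.
have [jh|hj] := ltnP j (N * h).
  rewrite (_ : _ `&` _ = set0) ?pr0//; apply/seteqP; split=> x //= -[[_ Vx] lx].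
  by apply: Vx; rewrite /V/= lx.
apply/eqP; rewrite eq_le pr_ge0 andbT.
apply: (@le_trans _ _ (pr (l' @^-1` [set (j : nat)] `&` T @^-1` V))).
  by apply: pr_le; [exact: measurableI|exact: measurableI|move=> x [[Dx _] lx]].
rewrite shift// modn_small// (_ : _ `&` _ = set0) ?pr0//.
apply/seteqP; split=> x //= [lx]; rewrite /V/= lx ltnNge.
by rewrite leqW.
Qed.

Let pr_escape_iter i : pr (iter i T @^-1` V `\` V) <= i%:R / N'%:R.
Proof.
have mi k : measurable (iter k T @^-1` V `\` V).
  by apply: measurableD => //; exact: (measurable_iter Tmp).
elim: i => [|i IH].
  by rewrite mul0r (_ : _ `\` _ = set0) ?pr0//; apply/seteqP; split=> x // [].
have mD : measurable (T @^-1` V `\` V) by exact: (mi 1%N).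
rewrite -[i.+1%:R]natr1 mulrDl mul1r addrC.
apply: (le_trans _ (lerD pr_escape IH)).
rewrite -(pr_iter Tmp i mD); apply: pr_le2 => //; first exact: (measurable_iter Tmp).
move=> x /= [Tx Vx]; have [TVx|nTVx] := pselect (V (iter i T x)); last by left.
by right.
Qed.

(* V is almost invariant under N iterations, while on every cell of l it is
   nested with C; hence averages of C over N steps remember V. *)
Lemma deviation_lower : 2^-1 * \sum_(j < N) Num.min
    (pr (l @^-1` [set (j : nat)] `&` C)) (pr (l @^-1` [set (j : nat)] `\` C)) -
  (2 * h)%:R^-1 <= deviation mu T C N.
Proof.
have NR : (0 : R) < N%:R by rewrite ltr0n.
have mCi i : measurable (iter i T @^-1` C) by exact: (measurable_iter Tmp).
(* Fewer than [N] steps among [N * (2 * h)] labels lose mass at most [1 / (2 * h)]. *)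
have stay i : (i < N)%N ->
    pr (C `&` V) - (2 * h)%:R^-1 <= pr (iter i T @^-1` C `&` V).
  move=> iN; have mCV : measurable (C `&` V) by exact: measurableI.
  have e : i%:R / N'%:R <= (2 * h)%:R^-1 :> R.
    rewrite /N' natrM invfM mulrA ler_piMl ?invr_ge0//.
    by rewrite ler_pdivrMr// mul1r ler_nat ltnW.
  rewrite lerBlDr -(pr_iter Tmp i mCV).
  apply: (le_trans _ (lerD (lexx _) (le_trans (pr_escape_iter i) e))).
  apply: pr_le2; [exact: (measurable_iter Tmp)|exact: measurableI| |].
    by apply: measurableD => //; exact: (measurable_iter Tmp).
  move=> x /= [Cx Vx]; have [V'x|nVx] := pselect (V x); first by left.
  by right.
(* The signed deviation restricted to [V], hence a lower bound for its absolute value. *)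
pose g x : R := N%:R^-1 * (\sum_(0 <= i < N) \1_(iter i T @^-1` C `&` V) x) -
  pr C * \1_V x.
have bi i : bounded_measurable (\1_(iter i T @^-1` C `&` V) : X -> R).
  by apply: bm_indic; exact: measurableI.
have bs := bm_sum N bi; have bV := bm_indic (R := R) mV.
have bg : bounded_measurable g by apply: bmB; exact: bmZ.
apply: (@le_trans _ _ (ex mu g)); last first.
  apply: ex_le => //; first exact/bm_norm/bm_dev.
  move=> x; rewrite /g /visits.
  have [Vx|Vx] := pselect (V x); last first.
    rewrite [X in _ * X - _]big1 => [|i _].
      by rewrite indicE memNset// !mulr0 subrr.
    by rewrite indicE memNset// => -[].
  rewrite [\1_V x]indicE mem_set// mulr1; apply: (le_trans _ (ler_norm _)).
  rewrite lerD2r ler_pM2l ?invr_gt0//; apply: ler_sum => i _.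
  rewrite !indicE ler_nat; have [Ci|nC] := pselect (C (iter i T x)).
    by rewrite (mem_set Ci) leq_b1.
  by rewrite memNset// => -[].
rewrite /g (exB mu (bmZ _ bs) (bmZ _ bV)) (exZ mu _ bs) (exZ mu _ bV) ex_sum//.
rewrite ex_indic// pr_V.
have : N%:R^-1 * \sum_(0 <= i < N) (pr (C `&` V) - (2 * h)%:R^-1) <=
    N%:R^-1 * \sum_(0 <= i < N) ex mu \1_(iter i T @^-1` C `&` V).
  rewrite ler_pM2l ?invr_gt0//; apply: ler_sum_nat => i /andP[_ iN].
  by rewrite ex_indic ?stay//; exact: measurableI.
rewrite sumr_const_nat subn0 -[X in _ * X <= _]mulr_natl mulKf ?gt_eqF//.
move: pr_CV (_ * \sum_(0 <= i < N) _) ((2 * h)%:R^-1) => h1 q r h2; lra.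
Qed.

End lower_bound.

(** * Construction of an odometer from adaptively chosen sets *)

Section adapted_odometer.
Context {R : realType} {d : measure_display} {X : measurableType d}.
Variables (mu : probability X R).
Hypothesis hmu : lebesgue_probability_space mu.
Local Notation pr := (pr mu).

Variable C : (X -> nat) -> nat -> set X.
Hypothesis mC : forall l N, measurable (C l N).

(** The set used at a stage may depend on the labelling reached so far, so a set far from the
    current cells can be supplied at every stage. *)
Lemma adapted_odometer : exists (T : X -> X) (l : nat -> X -> nat) (N : nat -> nat),
  [/\ measure_preserving mu T, ergodic mu T,
      forall k, (k < N k)%N /\ uniform_labelling mu (l k) (N k) &
      forall k, 2^-1 * \sum_(j < N k) Num.min
          (pr (l k @^-1` [set (j : nat)] `&` C (l k) (N k)))
          (pr (l k @^-1` [set (j : nat)] `\` C (l k) (N k))) - k.+1%:R^-1 <=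
        deviation mu T (C (l k) (N k)) (N k)].
Proof.
have [phi coord] := exists_lebesgue_coordinate hmu.
have [mphi phi01 phi_itv _] := coord.
(* With this many pieces the oscillation sum [3 * N] meets the [4 ^+ k.+1] requirement of the next
   stage, and the loss [1 / (2 * h k)] is below [1 / k.+1]. *)
pose h k := (2 * 4 ^ k.+1)%N.
have h_gt0 k : (0 < h k)%N by rewrite muln_gt0 expn_gt0.
pose valid (k : nat) (s : (X -> nat) * nat) := uniform_labelling mu s.1 s.2 /\
  exists2 o, oscillation_bound phi s.1 o &
    4 ^+ k * \sum_(0 <= j < s.2) o j <= s.2%:R.
pose step (k : nat) (s s' : (X -> nat) * nat) :=
  [/\ s'.2 = (s.2 * (2 * h k))%N, forall x, (s'.1 x %% s.2)%N = s.1 x &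
      forall j, (j < s.2)%N ->
        pr (s.1 @^-1` [set j] `&` [set x | (s'.1 x < s.2 * h k)%N]) =
          (2 * s.2%:R)^-1 /\
        ((forall x, s.1 x = j -> (s'.1 x < s.2 * h k)%N -> C s.1 s.2 x) \/
         (forall x, s.1 x = j -> C s.1 s.2 x -> (s'.1 x < s.2 * h k)%N))].
have /choice[next hnext] : forall p : nat * ((X -> nat) * nat), exists s',
    valid p.1 p.2 -> valid p.1.+1 s' /\ step p.1 p.2 s'.
  move=> [k [l N]] /=; have [[lab [om osc fo]]|nv] := pselect (valid k (l, N));
    last by exists (l, N).
  rewrite /= in lab osc fo.
  have [l' [lab' mod' [om' osc' fo'] half]] :=
    refine_labelling mphi phi01 phi_itv lab (mC l N) (h_gt0 k).
  exists (l', (N * (2 * h k))%N) => _; split=> //; split=> //=.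
  exists om' => //; apply: (le_trans (ler_wpM2l (exprn_ge0 _ (ler0n _ 4)) fo')).
  have -> : (N * (2 * h k))%:R = 4 ^+ k.+1 * (4 * N%:R) :> R.
    by rewrite /h !natrM natrX; ring.
  rewrite ler_pM2l ?exprn_gt0//; have : 0 <= N%:R :> R by []; lra.
(* Stage 0 has a single cell, on which [phi] oscillates by at most 1. *)
pose st := fix st k :=
  if k is k'.+1 then next (k', st k') else ((fun=> 0%N) : X -> nat, 1%N).
have hst k : valid k (st k).
  elim: k => [|k IH]; last by have [] := hnext (k, st k) IH.
  split=> /=.
    split=> // [j|[|//]]; first exact: measurable_cst_set.
    rewrite (_ : _ @^-1` _ = setT) ?prT ?invr1//.
    by apply/seteqP; split.
  exists (fun=> 1); last by rewrite big_nat1 expr0 mul1r.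
  move=> x y _; have /andP[? ?] := phi01 x; have /andP[? ?] := phi01 y.
  by rewrite ler_norml; apply/andP; split; lra.
have sst k : step k (st k) (st k.+1) by have [] := hnext (k, st k) (hst k).
have /choice[om hom] : forall k, exists om, oscillation_bound phi (st k).1 om /\
    4 ^+ k * \sum_(0 <= j < (st k).2) om j <= (st k).2%:R.
  by move=> k; have [_ [om h1 h2]] := hst k; exists om.
have lab k : uniform_labelling mu (st k).1 (st k).2 by case: (hst k).
have mod k x : ((st k.+1).1 x %% (st k).2)%N = (st k).1 x by case: (sst k).
have NS k : (st k.+1).2 = ((st k).2 * (2 * h k))%N by case: (sst k).
have dvd k : ((st k).2 %| (st k.+1).2)%N by rewrite NS dvdn_mulr.
have /choice[y yP] : forall p : nat * nat, exists y,
    (p.2 < (st p.1).2)%N -> (st p.1).1 y = p.2.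
  move=> [k j] /=; have [/(label_nonempty (lab k))[y ly]|_] := ltnP j (st k).2.
    by exists y.
  by have [//|y _] := @label_nonempty _ _ _ _ _ _ (lab 0%N) 0; exists y.
have [T [Tmp Terg shift]] := @odometer_transformation _ _ _ _ _ coord
  (fun k => (st k).1) (fun k => (st k).2) om lab erefl mod dvd
  (fun k => (hom k).1) (fun k => (hom k).2) y (fun k j => yP (k, j)).
exists T, (fun k => (st k).1), (fun k => (st k).2); split=> //.
  move=> k; split=> //; elim: k => // k IH; rewrite NS.
  apply: (leq_ltn_trans IH); apply: ltn_Pmulr; last exact: leq_ltn_trans IH.
  by rewrite (@leq_mul 2 1)// h_gt0.
move=> k; have [_ _ half] := sst k.
have lab' := lab k.+1; rewrite NS in lab'.
have shift' j A : (j < (st k).2 * (2 * h k))%N -> measurable A ->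
    pr ((st k.+1).1 @^-1` [set j] `&` T @^-1` A) =
    pr ((st k.+1).1 @^-1` [set (j.+1 %% ((st k).2 * (2 * h k)))%N] `&` A).
  by move=> jN mA; rewrite -NS in jN *; exact: shift.
apply: le_trans (deviation_lower Tmp (lab k) lab' (mC _ _) (h_gt0 k) half shift').
rewrite lerD2l lerN2 lef_pV2 ?posrE ?ltr0n ?muln_gt0 ?h_gt0//.
rewrite ler_nat /h mulnA; apply: (@leq_trans (4 ^ k.+1)); last by rewrite leq_pmull.
  by apply: ltnW; exact: ltn_expl.
by rewrite expn_gt0.
Qed.

End adapted_odometer.

(** * Uniform convergence of averages and total boundedness *)

Lemma limn_esup_le (R : realType) (u : (\bar R)^nat) c N :
  (forall n, (N <= n)%N -> (u n <= c)%E) -> (limn_esup u <= c)%E.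
Proof.
move=> h; rewrite limn_esup_lim; apply: lime_le; first exact: is_cvg_esups.
near=> n; apply: ge_ereal_sup => _ [m /= nm <-]; apply: h.
by apply: leq_trans nm; near: n; exists N.
Unshelve. all: by end_near. Qed.

Section uniform_mean_ergodic.
Context {R : realType} {d : measure_display} {X : measurableType d}.
Variables (mu : probability X R) (F : set (set X)).
Hypothesis mF : forall C, F C -> measurable C.
Local Notation pr := (pr mu).

Lemma totally_bounded_uniform_mean_ergodic (T : X -> X) :
  totally_bounded mu F -> F !=set0 -> measure_preserving mu T -> ergodic mu T ->
  (fun n : nat => ereal_sup [set ergodic_deviation mu T C n | C in F]) @ \oo --> 0%E.
Proof.
move=> tbF [C0 FC0] Tmp Terg; apply: limn_esup_le_cvg; last first.
  move=> n; apply: (@le_trans _ _ (ergodic_deviation mu T C0 n)).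
    by apply: integral_ge0 => x _; rewrite lee_fin.
  by apply: ereal_sup_ubound; exists C0.
apply/lee_addgt0Pr => e e0; rewrite add0e.
have e40 : 0 < e / 4 by rewrite divr_gt0.
have [I [U [mU hU]]] := tbF (e / 4) e40.
have /choice[M hM] : forall i, exists M, forall n, (M <= n)%N ->
    deviation mu T (U i) n <= e / 2.
  by move=> i; apply: mean_ergodic => //; rewrite divr_gt0.
(* The successor ensures [0 < n] for [deviation_perturb], whose bound is [e / 2 + 2 * (e / 4)]. *)
apply: (@limn_esup_le _ _ _ (\max_(i : I) M i).+1) => n nM.
apply: ge_ereal_sup => _ [C FC <-]; have [i hi] := hU C FC.
rewrite ergodic_deviationE ?lee_fin//; last exact: mF.
apply: (le_trans (deviation_perturb Tmp (mF FC) (mU i) (leq_trans _ nM))) => //.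
have := hM i n (leq_trans (leq_bigmax i) (ltnW nM)).
by move: hi; lra.
Qed.

Lemma uniform_mean_ergodic_totally_bounded :
  lebesgue_probability_space mu ->
  (forall T : X -> X, measure_preserving mu T -> ergodic mu T ->
     (fun n : nat => ereal_sup [set ergodic_deviation mu T C n | C in F])
       @ \oo --> 0%E) ->
  totally_bounded mu F /\ F !=set0.
Proof.
move=> hmu unif; split; last first.
  (* Some ergodic [T] exists, and along it the suprema over an empty family would be constantly
     [-oo]. *)
  have [T [l [N [Tmp Terg _ _]]]] :=
    adapted_odometer hmu (C := fun _ _ => set0) (fun _ _ => measurable0).
  apply/set0P/negP => /eqP F0; have := unif T Tmp Terg.
  rewrite F0 (_ : (fun _ => _) = fun=> -oo%E).
    by move=> /cvg_lim => /(_ (@ereal_hausdorff R)); rewrite lim_cst.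
  by apply/funext => n; rewrite image_set0 ereal_sup0.
apply: contrapT => ntb; have [C0 FC0] := not_totally_bounded_nonempty ntb.
have [e e0 hF] := not_totally_bounded mF ntb.
have /choice[G hG] : forall p : (X -> nat) * nat, exists C, F C /\
    (uniform_labelling mu p.1 p.2 ->
     e <= \sum_(j < p.2) Num.min (pr (p.1 @^-1` [set (j : nat)] `&` C))
                                 (pr (p.1 @^-1` [set (j : nat)] `\` C))).
  move=> [l N] /=; have [[N0 ml lN lu]|nl] := pselect (uniform_labelling mu l N);
    last by exists C0.
  pose Z x := Ordinal (lN x).
  have ZE (j : 'I_N) : Z @^-1` [set j] = l @^-1` [set (j : nat)].
    by apply/seteqP; split=> x /= => [<-//|lx]; exact: val_inj.
  have [C FC hC] := hF 'I_N Z (fun j => ltac:(by rewrite ZE)).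
  exists C; split=> // _; apply: (le_trans hC); apply: ler_sum => j _.
  by rewrite ZE.
have [T [l [N [Tmp Terg labN dev]]]] :=
  adapted_odometer hmu (C := fun l N => G (l, N)) (fun l N => mF (hG (l, N)).1).
have e40 : 0 < e / 4 by rewrite divr_gt0.
have /fine_cvgP[[M1 _ fin] cv] := unif T Tmp Terg.
have [M2 _ small] := cvgr_lt 0 cv (e / 4) e40.
pose M := maxn M1 M2.
(* For [k >= K] the deviation is at least [e / 2 - e / 5], which exceeds [e / 4]. *)
have [K hK] := archimedean_bound 1 (divr_gt0 e0 (ltr0n R 5)).
pose k := maxn M K; have [kN lab] := labN k.
have Mk : (M <= N k)%N by rewrite (leq_trans _ (ltnW kN))// leq_maxl.
have M1k : (M1 <= N k)%N by exact: leq_trans (leq_maxl _ _) Mk.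
have M2k : (M2 <= N k)%N by exact: leq_trans (leq_maxr _ _) Mk.
have := small (N k) M2k; rewrite /= ltNge => /negP; apply.
rewrite -lee_fin (fineK (fin (N k) M1k)).
apply: (@le_trans _ _ (ergodic_deviation mu T (G (l k, N k)) (N k))); last first.
  by apply: ereal_sup_ubound; exists (G (l k, N k)) => //; exact: (hG _).1.
rewrite ergodic_deviationE ?lee_fin//; last exact/mF/(hG _).1.
apply: le_trans (dev k); have /= := (hG (l k, N k)).2 lab.
have : k.+1%:R^-1 <= e / 5.
  rewrite -[leLHS]mul1r ler_pdivrMr//; apply: (le_trans hK).
  rewrite mulrC ler_pM2l ?divr_gt0// ler_nat.
  by apply: leqW; rewrite leq_maxr.
move: (k.+1%:R^-1) (\sum_(j < _) _) => a b; lra.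
Qed.

End uniform_mean_ergodic.

Theorem theorem1 (R : realType) (d : measure_display) (X : measurableType d)
    (mu : probability X R) (hmu : lebesgue_probability_space mu)
    (F : set (set X)) (hF : forall C : set X, F C -> measurable C) :
  family_entropy mu F = 0%E <->
  (forall T : X -> X, measure_preserving mu T -> ergodic mu T ->
     (fun n : nat => ereal_sup [set ergodic_deviation mu T C n | C in F])
       @ \oo --> 0%E).
Proof.
split=> [F0 T Tmp Terg|unif].
  apply: totally_bounded_uniform_mean_ergodic => //.
    exact: totally_bounded_family_entropy.
  (* An empty family has entropy [-oo], the supremum of the empty set, and not 0. *)
  apply/set0P/negP => /eqP Fe; move: F0; rewrite Fe /family_entropy.
  rewrite (_ : [set _ | _ in _] = set0) ?ereal_sup0//.
  by apply/seteqP; split=> // z [C hC _]; have := hC 0%N.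
have [tbF Fne] := uniform_mean_ergodic_totally_bounded hF hmu unif.
exact: family_entropy_totally_bounded.
Qed.
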